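(* Let $\lambda_1,\lambda_2,\mu_1,\mu_2>0$. If $\eta_1>0$, $\eta_2>0$ and $\eta_1(\mu_2-\lambda_2)+\eta_2(\mu_1-\lambda_1)>0$, then the joint steady-state probabilities $q_{n,i}$ of ${\bf N}=(N,\mathscr{E})$ can be expressed in terms of the roots $\xi_1>1$, $\xi_2>1$ and $0<\xi_3<1$ of the polynomial $$P(z)=\lambda_1\lambda_2z^3-\big[\lambda_1\lambda_2+\lambda_1\mu_2+\lambda_1\eta_2+\mu_1\lambda_2+\eta_1\lambda_2\big]z^2+\big[\lambda_1\mu_2+\mu_1\lambda_2+\mu_1\mu_2+\mu_1\eta_2+\eta_1\mu_2\big]z-\mu_1\mu_2$$ as follows: $$q_{n,i}=\frac{\eta_{3-i}}{\eta_1+\eta_2}\Bigl[A_i\,\mathbb{P}(V_1=n)+(1-A_i)\,\mathbb{P}(V_2=n)\Bigr],\qquad n\in\mathbb{N}_0,\ i=1,2,$$ where $\mathbb{P}(V_i=n)=(1-1/\xi_i)(1/\xi_i)^n$ for $n\in\mathbb{N}_0$, $i=1,2$, and $$A_i=\frac{\xi_1\xi_3\bigl[\eta_1(\mu_2-\lambda_2)+\eta_2(\mu_1-\lambda_1)\bigr]}{\lambda_i\mu_i(1-\xi_3)(\xi_1-1)(\xi_1-\xi_2)}\cdot\frac{\mu_i-\lambda_i\xi_2}{\mu_{3-i}-\lambda_{3-i}\xi_3},\qquad i=1,2.$$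
   Context: $\mathbb N_0=\{0,1,2,\dots\}$. $\{{\bf N}(t)=[N(t),\mathscr{E}(t)],\,t\ge 0\}$ is the continuous-time Markov chain on $\mathbb{N}_0\times\{1,2\}$ (an $M/M/1$ queue in two alternating environments; $N$ is the number of customers and $\mathscr{E}$ the environment) with the following transition rates: for $i=1,2$, $(n,i)\to(n+1,i)$ at rate $\lambda_i$ ($n\ge 0$), $(n,i)\to(n-1,i)$ at rate $\mu_i$ ($n\ge 1$), and $(n,i)\to(n,3-i)$ at rate $\eta_i$ ($n\ge 0$). The initial state is $(j,1)$ with probability $p$ and $(j,2)$ with probability $1-p$, for fixed $j\in\mathbb{N}_0$ and $p\in[0,1]$. Let $p_{n,i}(t)=\mathbb{P}[{\bf N}(t)=(n,i)]$. The random vector ${\bf N}=(N,\mathscr{E})$ describes the steady-state regime, and its joint steady-state probabilities are $q_{n,i}=\mathbb{P}(N=n,\mathscr{E}=i)=\lim_{t\to+\infty}p_{n,i}(t)$. *)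

(* Defs.v *)
From HB Require Import structures.
From mathcomp Require Import all_boot all_order all_algebra.
From mathcomp Require Import all_classical all_reals all_analysis.
Set Implicit Arguments.
Unset Strict Implicit.
Unset Printing Implicit Defensive.
Import Order.TTheory GRing.Theory Num.Theory.
Import numFieldNormedType.Exports.
Local Open Scope classical_set_scope.
Local Open Scope ring_scope.

(* The environments 1 and 2 are the two booleans, so that 3 - i is ~~ i and
   nat * bool carries the library's product sigma-algebra, in which every
   singleton is measurable. *)
Notation env1 := false.
Notation env2 := true.
Notation state := (nat * bool)%type.

Section MarkovChain.
Variable R : realType.

(* Honest (stochastic) transition function p t x y, for t >= 0, on a countable
   state space, whose matrix of derivatives at 0 is Q. *)
Definition transition_function (S : countType) (Q : S -> S -> R)
    (p : R -> S -> S -> R) : Prop :=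
  [/\ forall t x y, 0 <= t -> 0 <= p t x y,
      forall t x, 0 <= t -> \esum_(y in [set: S]) (p t x y)%:E = 1%E,
      forall x y, p 0 x y = (x == y)%:R,
      forall s t x y, 0 <= s -> 0 <= t ->
        (p (s + t) x y)%:E = \esum_(z in [set: S]) (p s x z * p t z y)%:E
    & forall x y, (p h x y - (x == y)%:R) / h @[h --> 0^'+] --> Q x y].

Context d (T : measurableType d) (P : probability T R).

Definition state_prob (X : R -> {RV P >-> state}) (t : R) (s : state) : R :=
  fine (P (X t @^-1` [set s])).

(* The finite list h of pairs (u, z) prescribes the past: X u = z at the listed
   times u <= s. The Markov property is P(past, X_s = x, X_(s+t) = y) =
   P(past, X_s = x) p_t(x, y), the product form avoiding conditioning on null
   events. The process is only looked at on nonnegative times. *)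
Definition markov_chain (Q : state -> state -> R)
    (X : R -> {RV P >-> state}) : Prop :=
  exists2 p : R -> state -> state -> R, transition_function Q p &
    forall (h : seq (R * state)) (s t : R) (x y : state),
      (forall e, e \in h -> 0 <= e.1 <= s) -> 0 <= s -> 0 <= t ->
      P ([set w | forall e, e \in h -> X e.1 w = e.2] `&`
         X s @^-1` [set x] `&` X (s + t) @^-1` [set y]) =
      (P ([set w | forall e, e \in h -> X e.1 w = e.2] `&`
          X s @^-1` [set x]) * (p t x y)%:E)%E.

Definition steady_state (X : R -> {RV P >-> state}) (q : state -> R) : Prop :=
  [/\ forall s, 0 <= q s,
      \esum_(s in [set: state]) (q s)%:E = 1%E
    & forall s, state_prob X t s @[t --> +oo] --> q s].

End MarkovChain.

Section Queue.
Variables (R : realType) (lambda mu eta : bool -> R).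

Definition queue_rate (x y : state) : R :=
  let: (n, i) := x in let: (m, k) := y in
  if k == i then
    if m == n.+1 then lambda i
    else if n == m.+1 then mu i
    else if m == n then - (lambda i + eta i + (if (0 < n)%N then mu i else 0))
    else 0
  else if m == n then eta i else 0.

Definition queue_poly : {poly R} :=
  let l1 := lambda env1 in let l2 := lambda env2 in
  let m1 := mu env1 in let m2 := mu env2 in
  let e1 := eta env1 in let e2 := eta env2 in
  (l1 * l2) *: 'X^3
  - (l1 * l2 + l1 * m2 + l1 * e2 + m1 * l2 + e1 * l2) *: 'X^2
  + (l1 * m2 + m1 * l2 + m1 * m2 + m1 * e2 + e1 * m2) *: 'X
  - (m1 * m2)%:P.

(* xi1, xi2, xi3 are all the roots, listed with multiplicity; the order of the
   two roots above 1 is left free. *)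
Definition queue_roots (xi1 xi2 xi3 : R) : Prop :=
  [/\ 1 < xi1, 1 < xi2, 0 < xi3 < 1
    & queue_poly = lead_coef queue_poly *:
        (('X - xi1%:P) * ('X - xi2%:P) * ('X - xi3%:P))].

Definition drift : R :=
  eta env1 * (mu env2 - lambda env2) + eta env2 * (mu env1 - lambda env1).

Definition mix_weight (xi1 xi2 xi3 : R) (i : bool) : R :=
  (xi1 * xi3 * drift) /
    (lambda i * mu i * (1 - xi3) * (xi1 - 1) * (xi1 - xi2)) *
  ((mu i - lambda i * xi2) / (mu (~~ i) - lambda (~~ i) * xi3)).

End Queue.

Definition geometric_pmf (R : realType) (xi : R) (n : nat) : R :=
  (1 - 1 / xi) * (1 / xi) ^+ n.

(* Main.v *)
Require Import Defs.
From HB Require Import structures.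
From mathcomp Require Import all_boot all_order all_algebra.
From mathcomp Require Import all_classical all_reals all_analysis.
From mathcomp Require Import ring lra.
Set Implicit Arguments.
Unset Strict Implicit.
Unset Printing Implicit Defensive.
Import Order.TTheory GRing.Theory Num.Theory.
Import numFieldNormedType.Exports.
Local Open Scope classical_set_scope.
Local Open Scope ring_scope.

(** The steady state comes from an ergodic theorem for a transition function p
    with bounded rates on a countable set, and from algebra identifying the
    invariant law of the queue.

    Distances between laws are measured by the excess of f over g, the sum of
    the positive parts of f - g. A stochastic kernel does not increase it
    ([excess_pushed]). Two facts about a strictly positive probability law q
    give the ergodic theorem.

    - If q solves the balance equations q Q = 0, then q P_t = q for all t
      ([balance_invariant]). Since rates are bounded, p h y y >= 1 - K h, so q
      loses at most a proportion K h of its mass at every state in a time h;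
      balance makes the loss o(h) at each single state. Since q is nearly
      concentrated on a finite set, the excess of q over q P_h is o(h). By the
      contraction property the excess of q over q P_t is at most n times the
      one for time t / n, hence zero.
    - If moreover some state y0 can be reached from everywhere, then
      p t x y tends to q y ([transition_cvg]). The law p t x stays below the
      multiple q / q x of q, so that, as long as its excess over q is at least
      e, half of the positive part and half of the negative part of p t x - q
      sit on one finite set that depends only on e and x. From this set the
      state y0 is reached with probability bounded below, the two parts cancel
      there, and the excess drops by a fixed amount in each unit of time
      ([distance_drop]). It therefore falls below e.

    For the queue, a sequence x^-n times a vector solves the balance equations
    away from level 0 exactly when x is a root of
    (z - 1) P(z) = a_1(z) a_2(z) - eta_1 eta_2 z^2 with
    a_i(z) = (lambda_i z - mu_i)(z - 1) - eta_i z.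
    Combining the modes of the two roots above 1 leaves one boundary condition
    per environment, and the combination
    (mu - lambda x2) x1^-n - (mu - lambda x1) x2^-n satisfies it
    ([two_mode], [balance_interior], [balance_boundary]). This is the announced
    mixture of geometric laws ([weight_mode]). Its weights may be negative;
    positivity ([two_mode_gt0]) holds because lambda x1 >= mu for the larger
    root x1. The necessary position of the roots with respect to the inverse
    loads mu_i / lambda_i, and the fact that x1 and x2 differ, follow from the
    sign of P at these inverse loads ([load_product]).

    Any triple of roots thus gives a limit of the state probabilities, so that
    uniqueness of limits makes the formula independent of the triple. *)

(** * Sums over a countable set *)

Section Mass.
Variables (R : realType) (S : countType).
Implicit Types f g : S -> R.

Definition mass f : \bar R := \esum_(x in [set: S]) (f x)%:E.

Lemma eq_mass f g : f =1 g -> mass f = mass g.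
Proof. by move=> fg; apply: eq_esum => x _; rewrite fg. Qed.

Lemma le_mass f g : (forall x, f x <= g x) -> (mass f <= mass g)%E.
Proof. by move=> fg; apply: le_esum => x _; rewrite lee_fin. Qed.

Lemma mass_ge0 f : (forall x, 0 <= f x) -> (0 <= mass f)%E.
Proof. by move=> f0; apply: esum_ge0 => x _; rewrite lee_fin. Qed.

Lemma massD f g : (forall x, 0 <= f x) -> (forall x, 0 <= g x) ->
  mass (fun x => f x + g x) = (mass f + mass g)%E.
Proof. by move=> f0 g0; rewrite /mass -esumD// => x _; rewrite lee_fin. Qed.

Lemma sum_le_mass f (s : seq S) : (forall x, 0 <= f x) -> uniq s ->
  ((\sum_(x <- s) f x)%:E <= mass f)%E.
Proof.
move=> f0 us; apply: esum_ge; exists [set` s].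
  by split=> //; exact: finite_seq.
by rewrite -fsbig_seq// sumEFin.
Qed.

Lemma le_mass1 f x : (forall x, 0 <= f x) -> ((f x)%:E <= mass f)%E.
Proof.
by move=> f0; have := @sum_le_mass f [:: x] f0 isT; rewrite big_seq1.
Qed.

Lemma massZ (c : R) f : 0 <= c -> (forall x, 0 <= f x) ->
  mass (fun x => c * f x) = (c%:E * mass f)%E.
Proof.
have half (a : R) (g : S -> R) : 0 < a -> (forall x, 0 <= g x) ->
    (mass (fun x => (a * g x)%R) <= a%:E * mass g)%E.
  move=> a0 g0; apply: ge_ereal_sup => _ [A [finA _] <-].
  under eq_fsbigr do rewrite EFinM.
  rewrite -ge0_mule_fsumr; last by move=> i; rewrite lee_fin.
  rewrite lee_pmul2l ?lte_fin//.
  by apply: esum_ge; exists A.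
rewrite le_eqVlt => /predU1P[<-|c0] f0.
  rewrite mul0e; apply: esum1 => x _; by rewrite mul0r.
apply/eqP; rewrite eq_le half//=.
have ci : 0 < c^-1 by rewrite invr_gt0.
have cf0 x : 0 <= c * f x by rewrite mulr_ge0// ltW.
have := half _ _ ci cf0.
rewrite (@eq_mass _ f) => [|x]; last by rewrite mulrA mulVf ?gt_eqF// mul1r.
by rewrite lee_pdivlMl.
Qed.

Lemma mass_exchange (F : S -> S -> R) : (forall x y, 0 <= F x y) ->
  \esum_(x in [set: S]) mass (F x) =
  \esum_(y in [set: S]) mass (F ^~ y).
Proof.
move=> F0; rewrite /mass !esum_esum; try by move=> *; rewrite lee_fin.
apply: (@reindex_esum _ _ _ _ _ (fun z : S * S => (z.2, z.1))
  (fun z => (F z.1 z.2)%:E)).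
split=> [[a b]|[a b] [c e] _ _ [-> ->]|[a b] _] //=.
by exists (b, a).
Qed.

(** A summable function is concentrated, up to any prescribed mass, on a
    finite set. This tightness is what both halves of the ergodic theorem use
    to treat infinitely many states at once. *)
Lemma mass_tail f (e : R) : (forall x, 0 <= f x) -> mass f \is a fin_num ->
  0 < e ->
  exists s : seq S, (mass (fun x => if x \in s then 0%R else f x) <= e%:E)%E.
Proof.
move=> f0 ffin e0.
have [_ [A [finA _] <-] Ae] := ub_ereal_sup_adherent e0 ffin.
have /finite_seqP[s As] := finA; exists s.
pose f1 x := if x \in s then f x else 0.
pose f2 x := if x \in s then 0 else f x.
have f10 x : 0 <= f1 x by rewrite /f1; case: ifP.
have f20 x : 0 <= f2 x by rewrite /f2; case: ifP.
have fE : mass f = (mass f1 + mass f2)%E.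
  by rewrite -massD//; apply: eq_mass => x; rewrite /f1 /f2; case: ifP;
    rewrite ?addr0 ?add0r.
have f1E : (\sum_(x \in A) (f x)%:E)%R = mass f1.
  rewrite -esum_fset//; last by move=> i _; rewrite lee_fin.
  rewrite esum_mkcond; apply: eq_esum => x _.
  by rewrite /f1 As mem_setE; case: ifP.
have {Ae} : (mass f - e%:E < mass f1)%E by rewrite -f1E.
rewrite -/f2 fE.
have sub_fin h : (forall x, 0 <= h x) -> (mass h <= mass f)%E ->
    mass h \is a fin_num.
  move=> h0 hf; rewrite ge0_fin_numE ?mass_ge0//; apply: le_lt_trans hf _.
  by rewrite ltey_eq ffin.
have /fineK <- : mass f1 \is a fin_num.
  by apply: sub_fin => //; rewrite fE leeDl// mass_ge0.
have /fineK <- : mass f2 \is a fin_num.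
  by apply: sub_fin => //; rewrite fE leeDr// mass_ge0.
rewrite -EFinN -!EFinD lte_fin lee_fin; lra.
Qed.

(** The positive part of the difference, summed: total variation distance as
    soon as the two masses agree. *)
Definition excess f g : \bar R := mass (fun x => Num.max (f x - g x) 0).

Lemma excess_ge0 f g : (0 <= excess f g)%E.
Proof. by apply: mass_ge0 => x; rewrite le_max lexx orbT. Qed.

Lemma excess_le_mass f g : (forall x, 0 <= f x) -> (forall x, 0 <= g x) ->
  (excess f g <= mass f)%E.
Proof.
by move=> f0 g0; apply: le_mass => x; rewrite ge_max f0 gerBl g0.
Qed.

Lemma excess_sym f g : (forall x, 0 <= f x) -> (forall x, 0 <= g x) ->
  mass f = 1%E -> mass g = 1%E -> excess f g = excess g f.
Proof.
move=> f0 g0 f1 g1.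
pose m x := Num.min (f x) (g x).
have m0 x : 0 <= m x by rewrite le_min f0 g0.
have fE : mass f = (mass m + excess f g)%E.
  rewrite -massD// => [|x]; last by rewrite le_max lexx orbT.
  apply: eq_mass => x; rewrite /m.
  by case: (leP (f x) (g x)) => h; case: leP; lra.
have gE : mass g = (mass m + excess g f)%E.
  rewrite -massD// => [|x]; last by rewrite le_max lexx orbT.
  apply: eq_mass => x; rewrite /m.
  by case: (leP (f x) (g x)) => h; case: leP; lra.
have mfin : mass m \is a fin_num.
  rewrite ge0_fin_numE ?mass_ge0//; apply: le_lt_trans (ltry 1).
  by rewrite -f1; apply: le_mass => x; rewrite /m ge_min lexx.
rewrite -[LHS](addeK _ mfin) -[RHS](addeK _ mfin).
by rewrite ![(_ + mass m)%E]addeC -fE -gE f1 g1.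
Qed.

Lemma excess_triangle f g h :
  (excess f h <= excess f g + excess g h)%E.
Proof.
rewrite -massD => [|x|x]; try by rewrite le_max lexx orbT.
apply: le_mass => x; rewrite ge_max.
have ge_pos (a : R) : a <= Num.max a 0 /\ 0 <= Num.max a 0.
  by rewrite !le_max !lexx orbT.
have [] := ge_pos (f x - g x); have [] := ge_pos (g x - h x); lra.
Qed.

(** * Stochastic kernels contract the excess *)

Definition pushed f (M : S -> S -> R) g :=
  forall y, (g y)%:E = mass (fun x => f x * M x y).

Definition stochastic (M : S -> S -> R) :=
  (forall x y, 0 <= M x y) /\ (forall x, mass (M x) = 1%E).

Lemma mass_kernel f M : stochastic M -> (forall x, 0 <= f x) ->
  \esum_(y in [set: S]) mass (fun x => f x * M x y) = mass f.
Proof.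
move=> [M0 M1] f0.
rewrite -(@mass_exchange (fun x y => f x * M x y)).
  by apply: eq_esum => x _; rewrite massZ// M1 mule1.
by move=> *; exact: mulr_ge0.
Qed.

Lemma mass_pushed f M g : stochastic M -> (forall x, 0 <= f x) ->
  pushed f M g -> mass g = mass f.
Proof.
by move=> sM f0 fg; rewrite -(mass_kernel sM f0); apply: eq_esum => y _.
Qed.

(** Doeblin's argument. Write f = m + u and g = m + v with m the common part.
    The images of u and of v both put mass at least c on y0, so that much of
    their mass cancels there, and the excess drops by c. With c = 0 this is
    the contraction property of a stochastic kernel. *)
Lemma excess_pushed_gain f g M f' g' y0 (c : R) : stochastic M ->
  (forall x, 0 <= f x) -> (forall x, 0 <= g x) ->
  pushed f M f' -> pushed g M g' -> 0 <= c ->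
  (c%:E <= mass (fun x => (Num.max (f x - g x) 0 * M x y0)%R))%E ->
  (c%:E <= mass (fun x => (Num.max (g x - f x) 0 * M x y0)%R))%E ->
  (excess f' g' + c%:E <= excess f g)%E.
Proof.
move=> sM f0 g0 ff gg c0 cu cv; have [M0 M1] := sM.
pose m x := Num.min (f x) (g x).
pose u x := Num.max (f x - g x) 0.
pose v x := Num.max (g x - f x) 0.
have m0 x : 0 <= m x by rewrite le_min f0 g0.
have u0 x : 0 <= u x by rewrite /u le_max lexx orbT.
have v0 x : 0 <= v x by rewrite /v le_max lexx orbT.
have fE y : (f' y)%:E = (mass (fun x => (m x * M x y)%R)
    + mass (fun x => (u x * M x y)%R))%E.
  rewrite ff -massD => [|x|x]; try exact: mulr_ge0.
  apply: eq_mass => x; rewrite -mulrDl; congr (_ * _).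
  by rewrite /m /u; case: (leP (f x) (g x)) => h; case: leP; lra.
have gE y : (g' y)%:E = (mass (fun x => (m x * M x y)%R)
    + mass (fun x => (v x * M x y)%R))%E.
  rewrite gg -massD => [|x|x]; try exact: mulr_ge0.
  apply: eq_mass => x; rewrite -mulrDl; congr (_ * _).
  by rewrite /m /v; case: (leP (f x) (g x)) => h; case: leP; lra.
have mu0 y : (0 <= mass (fun x => (m x * M x y)%R))%E.
  by apply: mass_ge0 => x; exact: mulr_ge0.
have uu0 y : (0 <= mass (fun x => (u x * M x y)%R))%E.
  by apply: mass_ge0 => x; exact: mulr_ge0.
have vv0 y : (0 <= mass (fun x => (v x * M x y)%R))%E.
  by apply: mass_ge0 => x; exact: mulr_ge0.
pose U y := fine (mass (fun x => u x * M x y)).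
pose V y := fine (mass (fun x => v x * M x y)).
pose W y := fine (mass (fun x => m x * M x y)).
have UE y : mass (fun x => u x * M x y) = (U y)%:E.
  rewrite fineK// ge0_fin_numE//; apply: le_lt_trans (ltry (f' y)).
  by rewrite fE leeDr.
have VE y : mass (fun x => v x * M x y) = (V y)%:E.
  rewrite fineK// ge0_fin_numE//; apply: le_lt_trans (ltry (g' y)).
  by rewrite gE leeDr.
have WE y : mass (fun x => m x * M x y) = (W y)%:E.
  rewrite fineK// ge0_fin_numE//; apply: le_lt_trans (ltry (f' y)).
  by rewrite fE leeDl.
pose D x : R := if x == y0 then c else 0.
have D0 x : 0 <= D x by rewrite /D; case: ifP.
apply: (@le_trans _ _ (mass U)); last first.
  rewrite -[leRHS](mass_kernel sM) //.
  by apply: le_esum => y _; rewrite UE.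
apply: (@le_trans _ _ (excess f' g' + mass D)%E).
  by rewrite leeD2l//; have := le_mass1 y0 D0; rewrite /D eqxx.
rewrite -massD// => [|x]; last by rewrite le_max lexx orbT.
apply: le_mass => y.
have f'E : f' y = W y + U y by apply/EFin_inj; rewrite EFinD -WE -UE -fE.
have g'E : g' y = W y + V y by apply/EFin_inj; rewrite EFinD -WE -VE -gE.
have UV : 0 <= U y /\ 0 <= V y by rewrite -!lee_fin -UE -VE.
have cUV : y = y0 -> c <= U y /\ c <= V y.
  by move=> ->; rewrite -!lee_fin -UE -VE.
rewrite f'E g'E -lerBrDr ge_max /D.
by case: UV => ? ?; case: eqP => [/cUV[? ?]|_]; apply/andP; split; lra.
Qed.

Lemma excess_pushed f g M f' g' : stochastic M ->
  (forall x, 0 <= f x) -> (forall x, 0 <= g x) ->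
  pushed f M f' -> pushed g M g' -> (excess f' g' <= excess f g)%E.
Proof.
move=> sM f0 g0 ff gg; have [M0 _] := sM.
have [S0|/set0P[y0 _]] := eqVneq [set: S] set0.
  by rewrite {1}/excess /mass S0 esum_set0 excess_ge0.
rewrite -[leLHS]adde0.
by apply: (excess_pushed_gain (y0 := y0) sM f0 g0 ff gg) => //;
  apply: mass_ge0 => x; rewrite mulr_ge0// le_max lexx orbT.
Qed.

End Mass.

(** * Transition functions at short times *)

Section TransitionFunction.
Variables (R : realType) (S : countType).
Variables (Q : S -> S -> R) (p : R -> S -> S -> R).
Hypothesis tf : transition_function Q p.

Lemma tf_stochastic t : 0 <= t -> stochastic (p t).
Proof.
by case: tf => p0 p1 _ _ _ t0; split=> [x y|x]; [exact: p0|exact: p1].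
Qed.

Lemma tf_ge0 t x y : 0 <= t -> 0 <= p t x y.
Proof. by case: tf => p0 _ _ _ _; exact: p0. Qed.

Lemma tf_le1 t x y : 0 <= t -> p t x y <= 1.
Proof.
move=> t0; have [p0 p1] := tf_stochastic t0.
by rewrite -lee_fin -(p1 x) (le_mass1 y)// => z; exact: p0.
Qed.

Lemma tf_chapman_kolmogorov s t x : 0 <= s -> 0 <= t ->
  pushed (p s x) (p t) (p (s + t) x).
Proof. by case: tf => _ _ _ ck _ s0 t0 y; exact: ck. Qed.

Lemma tf_mul s t x z y : 0 <= s -> 0 <= t ->
  p s x z * p t z y <= p (s + t) x y.
Proof.
move=> s0 t0; rewrite -lee_fin tf_chapman_kolmogorov//.
apply: (@le_mass1 _ _ (fun z => p s x z * p t z y) z) => w.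
by rewrite mulr_ge0// tf_ge0.
Qed.

Lemma tf_rate_lower x y e : 0 < e ->
  \forall h \near 0^'+, (x == y)%:R + (Q x y - e) * h <= p h x y.
Proof.
move=> e0; case: tf => _ _ _ _ /(_ x y)/cvgrPdist_le/(_ _ e0).
move=> H; near=> h.
have h0 : 0 < h by near: h; exact: nbhs_right_gt.
have : `|Q x y - (p h x y - (x == y)%:R) / h| <= e by near: h.
rewrite ler_distlC => /andP[+ _].
by rewrite ler_pdivlMr// => ?; lra.
Unshelve. all: by end_near. Qed.

Lemma near0_divn (P : R -> Prop) t : 0 < t -> (\forall h \near 0^'+, P h) ->
  exists2 n : nat, (0 < n)%N & P (t / n%:R).
Proof.
move=> t0 [e /= e0 He].
pose n := (Num.truncn (t / e)).+1.
exists n => //; apply: He => /=; last by rewrite divr_gt0// ltr0n.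
rewrite sub0r normrN gtr0_norm ?divr_gt0 ?ltr0n//.
rewrite ltr_pdivrMr ?ltr0n// mulrC -ltr_pdivrMr//.
by rewrite truncnS_gt.
Qed.

Lemma tf_diag_exp n h y : 0 <= h -> p h y y ^+ n <= p (n%:R * h) y y.
Proof.
move=> h0; elim: n => [|n IH].
  by rewrite mul0r expr0; case: tf => _ _ -> _ _; rewrite eqxx.
rewrite -natr1 mulrDl mul1r exprSr.
apply: le_trans (tf_mul y y y _ h0); last by rewrite mulr_ge0.
by rewrite ler_wpM2r// tf_ge0.
Qed.

Lemma bernoulli_sub (a : R) n : 0 <= a <= 1 -> 1 - n%:R * a <= (1 - a) ^+ n.
Proof.
move=> /andP[a0 a1]; elim: n => [|n IH]; first by rewrite mul0r subr0 expr0.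
rewrite exprSr; apply: (@le_trans _ _ ((1 - n%:R * a) * (1 - a))); last first.
  by rewrite ler_wpM2r// subr_ge0.
have n0 : 0 <= n%:R :> R by [].
have := mulr_ge0 n0 (mulr_ge0 a0 a0); rewrite -natr1; lra.
Qed.

(** The bound holds up to o(t) for small t by definition of the rate, and
    the powers of p at a short time carry it over to every t. *)
Lemma tf_diag_lower K t y : 0 <= K -> - K <= Q y y -> 0 <= t ->
  1 - K * t <= p t y y.
Proof.
move=> K0 KQ; rewrite le_eqVlt => /predU1P[<-|t0].
  by case: tf => _ _ -> _ _; rewrite eqxx mulr0 subr0.
apply/ler_addgt0Pr => e e0.
pose d := e / t; have d0 : 0 < d by rewrite divr_gt0.
have Kd : 0 < K + d by rewrite ltr_wpDl.
have [n n0] : exists2 n : nat, (0 < n)%N &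
    1 - (K + d) * (t / n%:R) <= p (t / n%:R) y y /\ (K + d) * (t / n%:R) <= 1.
  apply: (@near0_divn (fun h => 1 - (K + d) * h <= p h y y /\ (K + d) * h <= 1)
    t t0); near=> h.
  have h0 : 0 < h by near: h; exact: nbhs_right_gt.
  split.
    have : (y == y)%:R + (Q y y - d) * h <= p h y y.
      by near: h; apply: tf_rate_lower.
    rewrite eqxx; apply: le_trans; rewrite -mulNr lerD2l.
    by rewrite ler_wpM2r ?(ltW h0)//; lra.
  rewrite mulrC -ler_pdivlMr// mul1r; apply: ltW; near: h.
  by apply: nbhs_right_lt; rewrite invr_gt0.
have tn0 : 0 <= t / n%:R by rewrite divr_ge0// ltW.
move=> [pn le1].
have := tf_diag_exp n y tn0.
rewrite mulrCA mulfV ?pnatr_eq0 -?lt0n// mulr1 => pt.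
have nE : 1 - n%:R * ((K + d) * (t / n%:R)) = 1 - K * t - e.
  by rewrite /d; field; rewrite pnatr_eq0 -lt0n n0 gt_eqF.
have B : 1 - n%:R * ((K + d) * (t / n%:R)) <= (1 - (K + d) * (t / n%:R)) ^+ n.
  by apply: bernoulli_sub; rewrite le1 mulr_ge0// ltW.
suff : (1 - (K + d) * (t / n%:R)) ^+ n <= p (t / n%:R) y y ^+ n by lra.
by rewrite lerXn2r// nnegrE ?subr_ge0// tf_ge0.
Unshelve. all: by end_near. Qed.

Lemma tf_diag_gt0 K t y : 0 <= K -> - K <= Q y y -> 0 <= t -> 0 < p t y y.
Proof.
move=> K0 KQ; rewrite le_eqVlt => /predU1P[<-|t0].
  by case: tf => _ _ -> _ _; rewrite eqxx.
have [n n0 Kn] : exists2 n : nat, (0 < n)%N & K * (t / n%:R) < 1.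
  apply: (@near0_divn (fun h => K * h < 1) t t0); near=> h.
  have h0 : 0 < h by near: h; exact: nbhs_right_gt.
  apply: (@le_lt_trans _ _ ((K + 1) * h)); first by rewrite ler_pM2r//; lra.
  rewrite mulrC -ltr_pdivlMr ?mul1r; last by lra.
  by near: h; apply: nbhs_right_lt; rewrite invr_gt0; lra.
have tn0 : 0 <= t / n%:R by rewrite divr_ge0// ltW.
have := tf_diag_exp n y tn0.
rewrite mulrCA mulfV ?pnatr_eq0 -?lt0n// mulr1; apply: lt_le_trans.
apply: exprn_gt0; apply: lt_le_trans (tf_diag_lower K0 KQ tn0).
by rewrite subr_gt0.
Unshelve. all: by end_near. Qed.

(** Positivity at short times is the sign of the rate; staying at [y] for the
    remaining time has positive probability. *)
Lemma tf_edge_gt0 K t x y : 0 <= K -> - K <= Q y y -> x != y -> 0 < Q x y ->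
  0 < t -> 0 < p t x y.
Proof.
move=> K0 KQ xy Qxy t0; have Q2 : 0 < Q x y / 2 by rewrite divr_gt0.
have [n n0 pn] : exists2 n : nat, (0 < n)%N & 0 < p (t / n%:R) x y.
  apply: (@near0_divn (fun h => 0 < p h x y) t t0); near=> h.
  have h0 : 0 < h by near: h; exact: nbhs_right_gt.
  have : (x == y)%:R + (Q x y - Q x y / 2) * h <= p h x y.
    by near: h; apply: tf_rate_lower.
  rewrite (negbTE xy) add0r; apply: lt_le_trans; rewrite mulr_gt0//; lra.
have tn0 : 0 <= t / n%:R by rewrite divr_ge0// ltW.
have tnt : 0 <= t - t / n%:R.
  by rewrite subr_ge0 ler_pdivrMr ?ltr0n// ler_peMr ?ler1n ?(ltW t0).
have := tf_mul x y y tn0 tnt.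
rewrite addrCA subrr addr0; apply: lt_le_trans.
by rewrite mulr_gt0//; exact: tf_diag_gt0 K0 KQ tnt.
Unshelve. all: by end_near. Qed.

End TransitionFunction.

(** * Balanced laws are invariant *)

Lemma near_seq (T : Type) (I : eqType) (F : set_system T) (s : seq I)
    (P : I -> T -> Prop) : Filter F ->
  (forall i, i \in s -> \forall h \near F, P i h) ->
  \forall h \near F, forall i, i \in s -> P i h.
Proof.
move=> FF; elim: s => [|a s IH] H; first by apply: nearW.
have Ha : \forall h \near F, P a h by apply: H; rewrite mem_head.
have Hs : \forall h \near F, forall i, i \in s -> P i h.
  by apply: IH => i si; apply: H; rewrite in_cons si orbT.
near=> h => i; rewrite in_cons => /predU1P[->|si].
  by near: h.
by move: i si; near: h.
Unshelve. all: by end_near. Qed.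

Section Invariance.
Variables (R : realType) (S : countType).
Variables (Q : S -> S -> R) (p : R -> S -> S -> R) (q : S -> R) (K : R).
Hypothesis tf : transition_function Q p.
Hypothesis q_gt0 : forall x, 0 < q x.
Hypothesis q_mass : mass q = 1%E.
Hypothesis K_gt0 : 0 < K.
Hypothesis QK : forall x, - K <= Q x x.

Let q_ge0 x : 0 <= q x. Proof. exact: ltW. Qed.

Definition push_forward t y : R := fine (mass (fun x => q x * p t x y)).

Lemma push_forward_pushed t : 0 <= t -> pushed q (p t) (push_forward t).
Proof.
move=> t0 y; rewrite fineK// ge0_fin_numE; last first.
  by apply: mass_ge0 => x; rewrite mulr_ge0// (tf_ge0 tf).
apply: le_lt_trans (ltry 1); rewrite -q_mass; apply: le_mass => x.
by rewrite ler_piMr// (tf_le1 tf).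
Qed.

Lemma push_forward_ge0 t y : 0 <= t -> 0 <= push_forward t y.
Proof.
move=> t0; apply: fine_ge0; apply: mass_ge0 => x.
by rewrite mulr_ge0// (tf_ge0 tf).
Qed.

Lemma push_forward_mass t : 0 <= t -> mass (push_forward t) = 1%E.
Proof.
move=> t0.
by rewrite (mass_pushed (tf_stochastic tf t0) q_ge0 (push_forward_pushed t0)).
Qed.

Lemma push_forward_semigroup s t : 0 <= s -> 0 <= t ->
  pushed (push_forward s) (p t) (push_forward (s + t)).
Proof.
move=> s0 t0 y.
rewrite push_forward_pushed ?addr_ge0//.
pose F x z := q x * (p s x z * p t z y).
have F0 x z : 0 <= F x z by rewrite !mulr_ge0// (tf_ge0 tf).
transitivity (\esum_(x in [set: S]) mass (F x)).
  apply: eq_esum => x _.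
  rewrite massZ// => [|z]; last by rewrite mulr_ge0 ?(tf_ge0 tf).
  by rewrite EFinM (tf_chapman_kolmogorov tf).
rewrite mass_exchange//; apply: eq_esum => z _.
rewrite /F (@eq_mass _ _ _ (fun x => p t z y * (q x * p s x z))) => [|x];
  last by ring.
rewrite massZ ?(tf_ge0 tf)// => [|x]; last by rewrite mulr_ge0 ?(tf_ge0 tf).
by rewrite -push_forward_pushed// -EFinM mulrC.
Qed.

Hypothesis q_balance : forall y, exists s : seq S,
  [/\ uniq s, y \in s & \sum_(x <- s) q x * Q x y = 0].

(** Only finitely many states are listed in the balance equation at [y]. Keeping
    just those in the sum defining q P_h gives a lower bound, in which balance
    cancels the first-order term. *)
Lemma push_forward_near_lower y e : 0 < e ->
  \forall h \near 0^'+, q y - push_forward h y <= e * h.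
Proof.
move=> e0; have [s [us ys bal]] := q_balance y.
have : \forall h \near 0^'+, forall x, x \in s ->
    (x == y)%:R + (Q x y - e) * h <= p h x y.
  by apply: near_seq => x _; exact: (tf_rate_lower tf).
move=> H; near=> h.
have h0 : 0 < h by near: h; exact: nbhs_right_gt.
have pl : forall x, x \in s -> (x == y)%:R + (Q x y - e) * h <= p h x y.
  by near: h.
have : \sum_(x <- s) q x * p h x y <= push_forward h y.
  rewrite -lee_fin push_forward_pushed ?(ltW h0)//.
   apply: (@sum_le_mass _ _ (fun x => q x * p h x y)) => // x.
  by rewrite mulr_ge0 ?(tf_ge0 tf)// ltW.
have : \sum_(x <- s) (q x * (x == y)%:R + h * (q x * Q x y) - e * h * q x)
    <= \sum_(x <- s) q x * p h x y.
  rewrite big_seq [leRHS]big_seq; apply: ler_sum => x xs.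
  have := ler_wpM2l (q_ge0 x) (pl _ xs); apply: le_trans.
  by rewrite le_eqVlt; apply/orP; left; apply/eqP; ring.
rewrite !big_split/= -mulr_sumr bal mulr0 addr0 sumrN -mulr_sumr.
have -> : \sum_(x <- s) q x * (x == y)%:R = q y.
  rewrite (bigD1_seq y)//= eqxx mulr1 big1 ?addr0// => x /negbTE ->.
  by rewrite mulr0.
have : \sum_(x <- s) q x <= 1.
  by rewrite -lee_fin -q_mass; exact: sum_le_mass.
have eh : 0 <= e * h by rewrite mulr_ge0// ltW.
move=> /(ler_wpM2l eh); rewrite mulr1.
by lra.
Unshelve. all: by end_near. Qed.

(** Balance gives q P_h >= q - o(h) at each single state, and the loss is at
    most K h q(y) at every state y; tightness of q makes the total loss o(h). *)
Lemma excess_push_forward_small e : 0 < e ->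
  \forall h \near 0^'+, (excess q (push_forward h) <= (e * h)%:E)%E.
Proof.
move=> e0; pose e1 := e / 2 / K.
have e10 : 0 < e1 by rewrite !divr_gt0.
have qfin : mass q \is a fin_num by rewrite q_mass.
have [s sE] := mass_tail q_ge0 qfin e10.
(* An error proportional to q y is summable over s whatever the size of s. *)
have : \forall h \near 0^'+, forall y, y \in s ->
    q y - push_forward h y <= e / 2 * q y * h.
  by apply: near_seq => y _; apply: push_forward_near_lower; rewrite !mulr_gt0.
move=> H; near=> h.
have h0 : 0 < h by near: h; exact: nbhs_right_gt.
have pl : forall y, y \in s -> q y - push_forward h y <= e / 2 * q y * h.
  by near: h.
pose r y := if y \in s then 0 else q y.
have r0 y : 0 <= r y by rewrite /r; case: ifP.
have bound y :
    Num.max (q y - push_forward h y) 0 <= h * (e / 2) * q y + h * K * r y.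
  have a0 : 0 <= h * (e / 2) * q y by rewrite !mulr_ge0// ltW// divr_gt0.
  have b0 : 0 <= h * K * r y by rewrite !mulr_ge0// ltW.
  rewrite ge_max addr_ge0// andbT /r; case: ifPn => [ys|ys].
    by have := pl _ ys; lra.
  have : q y * p h y y <= push_forward h y.
    rewrite -lee_fin push_forward_pushed ?(ltW h0)//.
    apply: (@le_mass1 _ _ (fun x => q x * p h x y)) => x.
    by rewrite mulr_ge0 ?(tf_ge0 tf)// ltW.
  have := ler_wpM2l (q_ge0 y) (tf_diag_lower tf (ltW K_gt0) (QK y) (ltW h0)).
  by lra.
apply: (le_trans (le_mass bound)).
have he : 0 <= h * (e / 2) by rewrite ltW// mulr_gt0// divr_gt0.
have hK : 0 <= h * K by rewrite ltW// mulr_gt0.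
rewrite massD => [|y|y]; try by rewrite mulr_ge0.
rewrite !massZ// q_mass mule1.
have : ((h * K)%:E * mass r <= (h * K * e1)%:E)%E.
  by rewrite (EFinM (h * K) e1) lee_wpmul2l// lee_fin.
move=> /(leeD2l (h * (e / 2))%:E) /le_trans; apply.
rewrite -EFinD lee_fin le_eqVlt; apply/orP; left; apply/eqP.
by rewrite /e1; field; rewrite gt_eqF.
Unshelve. all: by end_near. Qed.

(** The semigroup pushes the pair (q, q P_(n h)) to (q P_h, q P_((n + 1) h)), so
    each further step costs at most the excess of q over q P_h. *)
Lemma excess_push_forward_iter n h : 0 <= h ->
  (excess q (push_forward (n%:R * h)) <= n%:R%:E * excess q (push_forward h))%E.
Proof.
move=> h0; elim: n => [|n IH].
  rewrite mul0e mul0r [X in (X <= _)%E](_ : _ = 0%E)//.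
  apply: esum1 => x _; rewrite (_ : push_forward 0 x = q x) ?subrr ?maxxx//.
  apply/EFin_inj.
  rewrite push_forward_pushed// /mass (esumID [set x]); last first.
    by move=> z _; rewrite lee_fin mulr_ge0 ?(tf_ge0 tf).
  rewrite setTI esum_set1 ?lee_fin ?mulr_ge0 ?(tf_ge0 tf)//.
  case: tf => _ _ p0 _ _; rewrite p0 eqxx mulr1 esum1 ?adde0// => z [_ /= zx].
  by rewrite p0 (introF eqP zx) mulr0.
apply: (le_trans (excess_triangle _ (push_forward h) _)).
rewrite -natr1 EFinD ge0_muleDl ?lee_fin// mul1e addeC.
rewrite leeD2r//; apply: le_trans IH.
rewrite mulrDl mul1r.
have nh : 0 <= n%:R * h by rewrite mulr_ge0.
apply: (excess_pushed (tf_stochastic tf h0) q_ge0).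
- by move=> y; exact: push_forward_ge0.
- exact: push_forward_pushed.
- exact: push_forward_semigroup.
Qed.

(** With step t / n the excess at time t is at most n times o(t / n). Having no
    excess over another law of the same mass means being equal to it. *)
Theorem balance_invariant t : 0 <= t -> pushed q (p t) q.
Proof.
move=> t0 y.
suff qE : push_forward t =1 q by rewrite -push_forward_pushed// qE.
have ex0 : excess q (push_forward t) = 0%E.
  move: t0; rewrite le_eqVlt => /predU1P[<-|t0].
    apply/eqP; rewrite eq_le excess_ge0 andbT.
    by have := excess_push_forward_iter 0 (lexx 0); rewrite !mul0r mul0e.
  apply/eqP; rewrite eq_le excess_ge0 andbT; apply/lee_addgt0Pr => e e0.
  rewrite add0e.
  have et : 0 < e / t by rewrite divr_gt0.
  have [n n0 small] := near0_divn t0 (excess_push_forward_small et).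
  have tn : 0 <= t / n%:R by rewrite divr_ge0// ltW.
  have := excess_push_forward_iter n tn.
  rewrite mulrCA mulfV ?pnatr_eq0 -?lt0n// mulr1 => /le_trans; apply.
  apply: le_trans (_ : _ <= n%:R%:E * (e / t * (t / n%:R))%:E)%E _.
    by rewrite lee_wpmul2l// lee_fin.
  rewrite -EFinM lee_fin le_eqVlt; apply/orP; left; apply/eqP.
  by field; rewrite pnatr_eq0 -lt0n n0 gt_eqF.
have ex0' : excess (push_forward t) q = 0%E.
  rewrite excess_sym ?push_forward_mass// => x; exact: push_forward_ge0.
have le0 f g x : excess f g = 0%E -> f x <= g x.
  move=> fg; have := @le_mass1 _ _ (fun x => Num.max (f x - g x) 0) x.
  rewrite -/(excess f g) fg lee_fin ge_max subr_le0 => H.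
  by have /andP[] := H (fun z => ltac:(by rewrite le_max lexx orbT)).
by move=> x; apply/eqP; rewrite eq_le !le0.
Qed.

End Invariance.

(** * Convergence to the invariant law *)

Section Convergence.
Variables (R : realType) (S : countType).
Variables (Q : S -> S -> R) (p : R -> S -> S -> R) (q : S -> R) (y0 : S).
Hypothesis tf : transition_function Q p.
Hypothesis q_gt0 : forall x, 0 < q x.
Hypothesis q_mass : mass q = 1%E.
Hypothesis q_invariant : forall t, 0 <= t -> pushed q (p t) q.
Hypothesis reach : forall x, 0 < p 1 x y0.

Let q_ge0 x : 0 <= q x. Proof. exact: ltW. Qed.

Let q_le1 x : q x <= 1.
Proof. by rewrite -lee_fin -q_mass; exact: le_mass1. Qed.

(** Started from [q], the chain starts at [x] with probability [q x]. This
    domination makes the laws [p t x], t >= 0, uniformly tight. *)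
Lemma tf_le_invariant t x y : 0 <= t -> p t x y <= (q x)^-1 * q y.
Proof.
move=> t0; rewrite mulrC ler_pdivlMr// mulrC -lee_fin (q_invariant t0).
apply: (@le_mass1 _ _ (fun x => q x * p t x y)) => z.
by rewrite mulr_ge0 ?(tf_ge0 tf).
Qed.

Let D x t := fine (excess (p t x) q).

Let DE x t : 0 <= t -> excess (p t x) q = (D x t)%:E.
Proof.
move=> t0; have [p0 p1] := tf_stochastic tf t0.
rewrite fineK// ge0_fin_numE ?excess_ge0//; apply: le_lt_trans (ltry 1).
by rewrite -(p1 x); exact: excess_le_mass.
Qed.

Lemma distance_nonincreasing x s t : 0 <= s -> 0 <= t -> D x (s + t) <= D x s.
Proof.
move=> s0 t0; rewrite -lee_fin -!DE ?addr_ge0//.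
apply: (excess_pushed (tf_stochastic tf t0)) => //.
- by move=> y; exact: (tf_ge0 tf).
- exact: (tf_chapman_kolmogorov tf).
- exact: q_invariant.
Qed.

(** Both signed parts of p t x - q are dominated by a multiple of q, so a
    fixed finite set carries at least half of each as long as they have mass
    e; from that set y0 is reached with probability bounded below. *)
Lemma distance_drop x e : 0 < e -> exists2 c, 0 < c &
  forall t, 0 <= t -> e <= D x t -> D x (t + 1) + c <= D x t.
Proof.
move=> e0; pose k := (q x)^-1.
have k0 : 0 < k by rewrite invr_gt0.
have k1 : 1 <= k by rewrite invf_ge1.
have ek : 0 < e / 2 / k by rewrite !divr_gt0.
have qfin : mass q \is a fin_num by rewrite q_mass.
have [s sE] := mass_tail q_ge0 qfin ek.
have [c c0 cs] : exists2 c, 0 < c & forall z, z \in s -> c <= p 1 z y0.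
  have : \forall c \near 0^'+, forall z, z \in s -> c <= p 1 z y0.
    by apply: near_seq => z _; exact: nbhs_right_le.
  move=> H.
  have : \forall c \near 0^'+, 0 < c /\ forall z, z \in s -> c <= p 1 z y0.
    by near=> c; split; near: c; [exact: nbhs_right_gt|exact: H].
  by move=> /filter_ex[c []]; exists c.
(* s misses at most e / 2 of any function of mass e dominated by k q. *)
exists (c * (e / 2)); first by rewrite mulr_gt0// divr_gt0.
move=> t t0 et; have t1 : 0 <= t + 1 by rewrite addr_ge0.
have [pt0 pt1] := tf_stochastic tf t0.
have gain (w : S -> R) : (forall z, 0 <= w z) -> (forall z, w z <= k * q z) ->
    (e%:E <= mass w)%E ->
    ((c * (e / 2))%:E <= mass (fun z => (w z * p 1 z y0)%R))%E.
  move=> w0 wq ew.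
  pose w1 z := if z \in s then w z else 0.
  pose w2 z := if z \in s then 0 else w z.
  have w10 z : 0 <= w1 z by rewrite /w1; case: ifP.
  have w20 z : 0 <= w2 z by rewrite /w2; case: ifP.
  have w2e : (mass w2 <= (e / 2)%:E)%E.
    apply: (@le_trans _ _ (mass (fun z => k * if z \in s then 0 else q z))).
      by apply: le_mass => z; rewrite /w2; case: ifP; rewrite ?mulr0.
    rewrite massZ ?(ltW k0)// => [|z]; last by case: ifP.
    apply: le_trans (_ : _ <= k%:E * (e / 2 / k)%:E)%E _.
      by rewrite lee_wpmul2l// lee_fin ltW.
    by rewrite -EFinM mulrC divfK ?gt_eqF.
  have w1e : ((e / 2)%:E <= mass w1)%E.
    have wE : mass w = (mass w1 + mass w2)%E.
      by rewrite -massD//; apply: eq_mass => z; rewrite /w1 /w2; case: ifP;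
        rewrite ?addr0 ?add0r.
    have : (e%:E <= mass w1 + (e / 2)%:E)%E.
      by rewrite (le_trans ew)// wE leeD2l.
    by rewrite -leeBlDr// -EFinB; apply: le_trans; rewrite lee_fin; lra.
  apply: (@le_trans _ _ (mass (fun z => c * w1 z))).
    by rewrite massZ ?(ltW c0)// EFinM lee_wpmul2l// lee_fin ltW.
  apply: le_mass => z; rewrite /w1; case: ifPn => [zs|_].
    by rewrite mulrC ler_wpM2l// cs.
  by rewrite mulr0 mulr_ge0// (tf_ge0 tf).
rewrite -lee_fin EFinD -!DE//.
have qkq z : q z <= k * q z by rewrite ler_peMl.
apply: (@excess_pushed_gain _ _ (p t x) q (p 1)) => //.
- exact: (tf_stochastic tf).
- exact: (tf_chapman_kolmogorov tf).
- exact: q_invariant.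
- by rewrite mulr_ge0 ?ltW// divr_gt0.
- apply: gain => [z|z|]; first by rewrite le_max lexx orbT.
    rewrite ge_max mulr_ge0 ?(ltW k0)// andbT.
    by rewrite (le_trans _ (tf_le_invariant x z t0))// gerBl.
  by rewrite -/(excess (p t x) q) DE// lee_fin.
- apply: gain => [z|z|]; first by rewrite le_max lexx orbT.
    rewrite ge_max mulr_ge0 ?(ltW k0)// andbT.
    by rewrite (le_trans _ (qkq z))// gerBl.
  by rewrite -/(excess q (p t x)) -excess_sym// DE// lee_fin.
Unshelve. all: by end_near. Qed.

(** The excess is nonincreasing and nonnegative, so it cannot drop by a fixed
    amount forever: it falls below any [e] and stays there. *)
Theorem transition_cvg x y : p t x y @[t --> +oo] --> q y.
Proof.
apply/cvgrPdist_le => /= e e0.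
have [c c0 drop] := distance_drop x e0.
have [n Dn] : exists n : nat, D x n%:R < e.
  apply: contrapT => /forallNP big.
  have le n : D x n%:R + n%:R * c <= D x 0.
    elim: n => [|n IH]; first by rewrite mul0r addr0.
    have /negP := big n; rewrite -leNgt => /(drop _ (ler0n _ n)).
    by rewrite -natr1 => ?; lra.
  pose n := (Num.truncn (D x 0 / c)).+1.
  have : D x 0 / c < n%:R by rewrite truncnS_gt.
  rewrite ltr_pdivrMr// ltNge (le_trans _ (le n))//.
  by rewrite lerDr -lee_fin -DE// excess_ge0.
near=> t.
have nt : n%:R <= t by near: t; exact: nbhs_pinfty_ge.
have t0 : 0 <= t by apply: le_trans nt.
have : D x t <= e.
  apply: le_trans (ltW Dn); rewrite -(subrKC n%:R t).
  by apply: distance_nonincreasing => //; rewrite subr_ge0.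
have [pt0 pt1] := tf_stochastic tf t0.
have pos (f g : S -> R) z : 0 <= Num.max (f z - g z) 0.
  by rewrite le_max lexx orbT.
have := @le_mass1 _ _ (fun z => Num.max (p t x z - q z) 0) y (pos _ _).
have := @le_mass1 _ _ (fun z => Num.max (q z - p t x z) 0) y (pos _ _).
rewrite -/(excess _ _) -/(excess _ _) -(excess_sym (f := p t x)) ?DE//.
rewrite !lee_fin !ge_max.
move=> /andP[a _] /andP[b _] De.
by rewrite ler_norml; apply/andP; split; lra.
Unshelve. all: by end_near. Qed.

End Convergence.

(** * The three roots and the inverse loads *)

Section RootAlgebra.
Variable R : realType.
Implicit Types l m e x : R.

(** Viete's relations for the polynomial. The primed parameters are those of
    the other environment; this form makes the symmetries between environments
    and between [x1] and [x2] usable as lemmas. *)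
Definition root_relations l m e l' m' e' x1 x2 x3 : Prop :=
  [/\ l * l' * (x1 + x2 + x3) = l * l' + l * m' + l * e' + m * l' + e * l',
      l * l' * (x1 * x2 + x1 * x3 + x2 * x3)
        = l * m' + m * l' + m * m' + m * e' + e * m'
    & l * l' * (x1 * x2 * x3) = m * m'].

Lemma root_relations_env l m e l' m' e' x1 x2 x3 :
  root_relations l m e l' m' e' x1 x2 x3 ->
  root_relations l' m' e' l m e x1 x2 x3.
Proof. by case=> ? ? ?; split; lra. Qed.

Lemma root_relations_swap l m e l' m' e' x1 x2 x3 :
  root_relations l m e l' m' e' x1 x2 x3 ->
  root_relations l m e l' m' e' x2 x1 x3.
Proof. by case=> ? ? ?; split; lra. Qed.

Section Relations.
Variables l m e l' m' e' x1 x2 x3 : R.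
Hypothesis rel : root_relations l m e l' m' e' x1 x2 x3.

Lemma drift_factor :
  e * (m' - l') + e' * (m - l) = l * l' * ((x1 - 1) * (x2 - 1) * (1 - x3)).
Proof. by case: rel => r1 r2 r3; lra. Qed.

(** The value of the polynomial at the inverse load m / l, cleared of
    denominators: its sign compares the loads of the two environments, which
    locates m / l among the roots. *)
Lemma load_product :
  l' * ((m - l * x1) * (m - l * x2) * (m - l * x3))
  = m * e * (l * m' - l' * m).
Proof.
case: rel => r1 r2 r3.
transitivity (l' * m ^+ 3 - m ^+ 2 * (l * l' * (x1 + x2 + x3))
  + m * l * (l * l' * (x1 * x2 + x1 * x3 + x2 * x3))
  - l ^+ 2 * (l * l' * (x1 * x2 * x3))); first by ring.
by rewrite r1 r2 r3; ring.
Qed.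

(** The symmetric functions of [x2] and [x3] are determined by [x1], so only
    [x1] remains on the right. *)
Lemma load_pair_product :
  l' * x1 * ((m - l * x2) * (m - l * x3))
  = m * (l * ((l' * x1 - m') * (x1 - 1) - e' * x1) - x1 * e * l').
Proof.
case: rel => r1 r2 r3.
transitivity (l' * x1 * m ^+ 2
  - m * x1 * (l * l' * (x1 + x2 + x3) - l * l' * x1)
  + l * (l * l' * (x1 * x2 * x3))); first by ring.
by rewrite r1 r3; ring.
Qed.

(** Multiplied by x1 - 1, the polynomial is the determinant of the 2 x 2 system
    satisfied by the amplitudes of a mode x1^-n in the two environments. *)
Lemma root_equation :
  ((l * x1 - m) * (x1 - 1) - e * x1) * ((l' * x1 - m') * (x1 - 1) - e' * x1)
  = x1 ^+ 2 * e * e'.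
Proof.
case: rel => r1 r2 r3.
have : l * l' * x1 ^+ 3 - x1 ^+ 2 * (l * l' * (x1 + x2 + x3))
  + x1 * (l * l' * (x1 * x2 + x1 * x3 + x2 * x3)) - l * l' * (x1 * x2 * x3) = 0.
  by ring.
rewrite r1 r2 r3 => P0; apply/eqP; rewrite -subr_eq0; apply/eqP.
rewrite -[RHS](mulr0 (x1 - 1)) -P0.
by ring.
Qed.

End Relations.

(** The two components of the eigenvector attached to the root [x1] balance
    the switches of environment; [load_pair_product], used in each of the two
    environments, turns the claim into [root_equation]. *)
Lemma environment_balance l m e l' m' e' x1 x2 x3 :
  root_relations l m e l' m' e' x1 x2 x3 -> x1 != 0 ->
  ((l * x1 - m) * (x1 - 1) - e * x1) * l' * m' * ((m - l * x2) * (m - l * x3))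
  + x1 * e * l * m * ((m' - l' * x2) * (m' - l' * x3)) = 0.
Proof.
move=> rel x10; apply: (mulfI x10); rewrite mulr0.
set a := (l * x1 - m) * (x1 - 1) - e * x1.
set b := (l' * x1 - m') * (x1 - 1) - e' * x1.
transitivity (a * m' * (l' * x1 * ((m - l * x2) * (m - l * x3)))
  + x1 * e * m * (l * x1 * ((m' - l' * x2) * (m' - l' * x3)))); first by ring.
rewrite (load_pair_product rel) (load_pair_product (root_relations_env rel)).
rewrite -/a -/b.
transitivity (m * m' * l * (a * b - x1 ^+ 2 * e * e')); first by ring.
by rewrite (root_equation rel) subrr mulr0.
Qed.

Variables l m e l' m' e' x1 x2 x3 : R.
Hypothesis rel : root_relations l m e l' m' e' x1 x2 x3.
Hypotheses (l_gt0 : 0 < l) (m_gt0 : 0 < m) (e_gt0 : 0 < e).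
Hypotheses (l'_gt0 : 0 < l') (m'_gt0 : 0 < m') (e'_gt0 : 0 < e').
Hypotheses (x1_gt1 : 1 < x1) (x2_gt1 : 1 < x2).
Hypotheses (x3_gt0 : 0 < x3) (x3_lt1 : x3 < 1).

Lemma drift_gt0 : 0 < e * (m' - l') + e' * (m - l).
Proof.
by rewrite (drift_factor rel) !mulr_gt0// subr_gt0.
Qed.

(** If the load l' / m' is at least l / m, stability forces m > l. Otherwise
    [load_product] is positive, while x3 >= m / l would give it two negative
    factors and one nonpositive one. *)
Lemma small_root_lt_inverse_load : 0 < m - l * x3.
Proof.
have [le_load|lt_load] := leP (l * m') (l' * m).
  have lm : l < m.
    rewrite ltNge; apply/negP => ml.
    have m'l' : m' <= l'.
      rewrite -(ler_pM2l l_gt0) (le_trans le_load)// mulrC ler_pM2r//.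
    have := drift_gt0; rewrite ltNge => /negP; apply.
    have e1 : e * (m' - l') <= 0 by rewrite pmulr_rle0// subr_le0.
    have e2 : e' * (m - l) <= 0 by rewrite pmulr_rle0// subr_le0.
    by lra.
  by rewrite subr_gt0 (lt_trans _ lm)// gtr_pMr.
rewrite ltNge; apply/negP => mx3.
have lx3 : l * x3 < l by rewrite gtr_pMr.
have lx1 : l < l * x1 by rewrite ltr_pMr.
have lx2 : l < l * x2 by rewrite ltr_pMr.
have n1 : m - l * x1 < 0 by lra.
have n2 : m - l * x2 < 0 by lra.
have := load_product rel; apply/eqP; rewrite lt_eqF//.
apply: (@le_lt_trans _ _ 0); last by rewrite !mulr_gt0// subr_gt0.
rewrite pmulr_rle0//; apply: mulr_ge0_le0; last by [].
by rewrite ltW// nmulr_rgt0.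
Qed.

End RootAlgebra.

Section StationaryAlgebra.
Variable R : realType.
Variables l m e l' m' e' x1 x2 x3 : R.
Hypothesis rel : root_relations l m e l' m' e' x1 x2 x3.
Hypotheses (l_gt0 : 0 < l) (m_gt0 : 0 < m) (e_gt0 : 0 < e).
Hypotheses (l'_gt0 : 0 < l') (m'_gt0 : 0 < m') (e'_gt0 : 0 < e').
Hypotheses (x1_gt1 : 1 < x1) (x2_gt1 : 1 < x2).
Hypotheses (x3_gt0 : 0 < x3) (x3_lt1 : x3 < 1).

Let rel' := root_relations_env rel.

Let below : 0 < m - l * x3.
Proof. exact: (small_root_lt_inverse_load rel). Qed.

Let below' : 0 < m' - l' * x3.
Proof. exact: (small_root_lt_inverse_load rel'). Qed.

(** If m / l exceeded both roots above 1, [load_product] would be positive, so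
    m' / l' would be larger still; but then the same product for the other
    environment is positive as well, and the loads compare both ways. *)
Lemma large_root_ge_inverse_load : x2 < x1 -> m <= l * x1.
Proof.
move=> x21; rewrite leNgt; apply/negP => lm.
have lm2 : l * x2 < m by rewrite (lt_trans _ lm)// ltr_pM2l.
have : 0 < m * e * (l * m' - l' * m).
  by rewrite -(load_product rel) !mulr_gt0// subr_gt0.
rewrite pmulr_rgt0 ?mulr_gt0// subr_gt0 => lt_load.
have lm' : l' * x1 < m'.
  rewrite -(ltr_pM2l l_gt0) (lt_trans _ lt_load)//.
  by rewrite mulrCA ltr_pM2l.
have lm2' : l' * x2 < m' by rewrite (lt_trans _ lm')// ltr_pM2l.
have : 0 < m' * e' * (l' * m - l * m').
  by rewrite -(load_product rel') !mulr_gt0// subr_gt0.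
by rewrite pmulr_rgt0 ?mulr_gt0// subr_gt0 ltNge ltW.
Qed.

(** At a double root both instances of [load_product] are nonnegative, so the
    loads agree and the double root is m / l = m' / l'; there
    [load_pair_product] equates zero with a negative number. *)
Lemma roots_distinct : x1 != x2.
Proof.
apply/eqP => x12; have x1p : 0 < x1 by exact: lt_trans x1_gt1.
have le1 : 0 <= m * e * (l * m' - l' * m).
  rewrite -(load_product rel) -x12 mulr_ge0 ?(ltW l'_gt0)//.
  by rewrite mulr_ge0 ?(ltW below)// -expr2 sqr_ge0.
have le2 : 0 <= m' * e' * (l' * m - l * m').
  rewrite -(load_product rel') -x12 mulr_ge0 ?(ltW l_gt0)//.
  by rewrite mulr_ge0 ?(ltW below')// -expr2 sqr_ge0.
have eq_load : l * m' = l' * m.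
  move: le1 le2; rewrite (pmulr_rge0 _ (mulr_gt0 m_gt0 e_gt0)).
  rewrite (pmulr_rge0 _ (mulr_gt0 m'_gt0 e'_gt0)) !subr_ge0 => h1 h2.
  by apply/eqP; rewrite eq_le h1 h2.
have := load_product rel; rewrite eq_load subrr mulr0 -x12 => /eqP.
rewrite !mulf_eq0 !(gt_eqF below, gt_eqF l'_gt0) orbF/= orbb => /eqP mx.
have mx' : m' = l' * x1.
  by apply: (mulfI (lt0r_neq0 l_gt0)); rewrite eq_load (subr0_eq mx); ring.
have := load_pair_product rel.
rewrite -x12 mx mul0r mulr0 mx' subrr mul0r sub0r => /esym/eqP.
by rewrite mulf_eq0 gt_eqF//= lt_eqF// subr_lt0 (@lt_trans _ _ 0)//
  ?mulr_gt0// mulrN oppr_lt0 !mulr_gt0.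
Qed.

End StationaryAlgebra.

(** * The two-mode solution of the balance equations *)

Section StationaryForm.
Variable R : realType.
Implicit Types l m e x : R.

Definition scale l m e l' m' e' x3 : R :=
  x3 * (e * (m' - l') + e' * (m - l)) / (l * m * (1 - x3) * (m' - l' * x3)).

(** The steady state within one environment, up to a constant factor. Dividing
    by [x1 - x2] makes it symmetric in the two roots, so that positivity may be
    proved for [x2 < x1] only. *)
Definition two_mode l m x1 x2 (n : nat) : R :=
  ((m - l * x2) * x1^-1 ^+ n - (m - l * x1) * x2^-1 ^+ n) / (x1 - x2).

Lemma two_modeC l m x1 x2 n : two_mode l m x1 x2 n = two_mode l m x2 x1 n.
Proof.
by rewrite /two_mode -(opprB x1 x2) invrN mulrN -mulNr opprB.
Qed.

Definition weight l m e l' m' e' x1 x2 x3 : R :=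
  (x1 * x3 * (e * (m' - l') + e' * (m - l)))
    / (l * m * (1 - x3) * (x1 - 1) * (x1 - x2))
  * ((m - l * x2) / (m' - l' * x3)).

Section Fixed.
Variables l m e l' m' e' x1 x2 x3 : R.
Hypothesis rel : root_relations l m e l' m' e' x1 x2 x3.
Hypotheses (l_gt0 : 0 < l) (m_gt0 : 0 < m) (e_gt0 : 0 < e).
Hypotheses (l'_gt0 : 0 < l') (m'_gt0 : 0 < m') (e'_gt0 : 0 < e').
Hypotheses (x1_gt1 : 1 < x1) (x2_gt1 : 1 < x2).
Hypotheses (x3_gt0 : 0 < x3) (x3_lt1 : x3 < 1).

Let rel' := root_relations_env rel.

Let below : 0 < m - l * x3.
Proof. exact: (small_root_lt_inverse_load rel). Qed.

Let below' : 0 < m' - l' * x3.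
Proof. exact: (small_root_lt_inverse_load rel'). Qed.

Let x12 : x1 - x2 != 0.
Proof. by rewrite subr_eq0; exact: (roots_distinct rel). Qed.

Let x1_neq0 : x1 != 0. Proof. by rewrite gt_eqF// (lt_trans _ x1_gt1). Qed.
Let x2_neq0 : x2 != 0. Proof. by rewrite gt_eqF// (lt_trans _ x2_gt1). Qed.
Let l_neq0 : l != 0. Proof. by rewrite gt_eqF. Qed.
Let m_neq0 : m != 0. Proof. by rewrite gt_eqF. Qed.
Let x21 : x2 - x1 != 0. Proof. by rewrite -opprB oppr_eq0. Qed.
Let x1B1 : x1 - 1 != 0. Proof. by rewrite subr_eq0 gt_eqF. Qed.
Let x2B1 : x2 - 1 != 0. Proof. by rewrite subr_eq0 gt_eqF. Qed.
Let x3B1 : 1 - x3 != 0. Proof. by rewrite subr_eq0 gt_eqF. Qed.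

(** Exchanging the roots exchanges the two weights of the mixture. This is what
    gives the second weight the same closed form as the first. *)
Lemma weight_swap :
  1 - weight l m e l' m' e' x1 x2 x3 = weight l m e l' m' e' x2 x1 x3.
Proof.
rewrite /weight (drift_factor rel).
have -> : m' = l * l' * (x1 * x2 * x3) / m.
  by case: rel => _ _ ->; field; rewrite gt_eqF.
have := below'.
have -> : m' = l * l' * (x1 * x2 * x3) / m.
  by case: rel => _ _ ->; field; rewrite gt_eqF.
move=> b'; have b'_neq0 : l * l' * (x1 * x2 * x3) + - (l' * x3) * m != 0.
  rewrite (_ : _ + _ = m * (l * l' * (x1 * x2 * x3) / m - l' * x3));
    last by field.
  by rewrite mulf_neq0// gt_eqF.
field.
by rewrite b'_neq0 m_neq0 l_neq0 x12 x21 x1B1 x2B1 x3B1.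
Qed.

Lemma weight_mode n :
  weight l m e l' m' e' x1 x2 x3 * geometric_pmf x1 n
  + (1 - weight l m e l' m' e' x1 x2 x3) * geometric_pmf x2 n
  = scale l m e l' m' e' x3 * two_mode l m x1 x2 n.
Proof.
rewrite weight_swap /weight /geometric_pmf /two_mode /scale !div1r.
move: (x1^-1 ^+ n) (x2^-1 ^+ n) => y1 y2.
field.
by rewrite m_neq0 l_neq0 x12 x21 x1B1 x2B1 x3B1 x1_neq0 x2_neq0 gt_eqF.
Qed.

Lemma scale_gt0 : 0 < scale l m e l' m' e' x3.
Proof.
rewrite /scale divr_gt0 ?mulr_gt0 ?subr_gt0 ?below'//.
  exact: (drift_gt0 rel).
by rewrite -subr_gt0.
Qed.

End Fixed.

(** For x2 < x1 the coefficient of x1^-n may be negative, but that of x2^-n is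
    not, and x2^-n >= x1^-n; replacing x2^-n by x1^-n leaves l x1^-n. *)
Lemma two_mode_gt0 l m e l' m' e' x1 x2 x3 n :
  root_relations l m e l' m' e' x1 x2 x3 ->
  0 < l -> 0 < m -> 0 < e -> 0 < l' -> 0 < m' -> 0 < e' ->
  1 < x1 -> 1 < x2 -> 0 < x3 -> x3 < 1 -> 0 < two_mode l m x1 x2 n.
Proof.
move=> + l0 m0 e0 l0' m0' e0' + + x30 x31.
wlog x21 : x1 x2 / x2 < x1 => [hw rel x11 x22|rel x1_gt1 x2_gt1].
  have : x1 != x2 by exact: (roots_distinct rel).
  rewrite neq_lt => /orP[lt12|lt21]; last exact: hw.
  by rewrite two_modeC; apply: hw => //; exact: root_relations_swap.
have lx1 : m <= l * x1 by exact: (large_root_ge_inverse_load rel).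
have x1_gt0 : 0 < x1 by exact: lt_trans x1_gt1.
have x2_gt0 : 0 < x2 by exact: lt_trans x2_gt1.
rewrite /two_mode divr_gt0 ?subr_gt0//.
have y12 : x1^-1 ^+ n <= x2^-1 ^+ n.
  rewrite lerXn2r ?nnegrE ?invr_ge0 ?(ltW x1_gt0) ?(ltW x2_gt0)//.
  by rewrite lef_pV2 ?posrE// ltW.
have y1 : 0 < x1^-1 ^+ n by rewrite exprn_gt0// invr_gt0.
have : (m - l * x1) * x2^-1 ^+ n <= (m - l * x1) * x1^-1 ^+ n.
  by rewrite ler_wnM2l// subr_le0.
move/le_lt_trans; apply; rewrite ltr_pM2r// ltrD2l ltrN2 ltr_pM2l//.
Qed.

(** The amplitudes chosen for one root solve the 2 x 2 linear system of its
    mode: [environment_balance] with the common factors restored. *)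
Lemma mode_equation l m e l' m' e' x1 x2 x3 :
  root_relations l m e l' m' e' x1 x2 x3 ->
  0 < l -> 0 < m -> 0 < l' -> 0 < m' -> x1 != 0 ->
  0 < m - l * x3 -> 0 < m' - l' * x3 -> x3 < 1 ->
  scale l m e l' m' e' x3 * ((m - l * x2) * ((l * x1 - m) * (x1 - 1) - e * x1))
  + e * x1 * (scale l' m' e' l m e x3 * (m' - l' * x2)) = 0.
Proof.
move=> rel l0 m0 l0' m0' x10 b b' x31.
pose c := x3 * (e * (m' - l') + e' * (m - l))
  / (l * m * l' * m' * (1 - x3) * (m - l * x3) * (m' - l' * x3)).
rewrite -[RHS](mulr0 c) -(environment_balance rel x10) /scale /c.
by field; rewrite !gt_eqF// subr_gt0.
Qed.

Section Balance.
Variables l m e l' m' e' x1 x2 x3 : R.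
Hypothesis rel : root_relations l m e l' m' e' x1 x2 x3.
Hypotheses (l_gt0 : 0 < l) (m_gt0 : 0 < m) (e_gt0 : 0 < e).
Hypotheses (l'_gt0 : 0 < l') (m'_gt0 : 0 < m') (e'_gt0 : 0 < e').
Hypotheses (x1_gt1 : 1 < x1) (x2_gt1 : 1 < x2).
Hypotheses (x3_gt0 : 0 < x3) (x3_lt1 : x3 < 1).

Let u n := scale l m e l' m' e' x3 * two_mode l m x1 x2 n.
Let u' n := scale l' m' e' l m e x3 * two_mode l' m' x1 x2 n.

Let below : 0 < m - l * x3.
Proof. exact: (small_root_lt_inverse_load rel). Qed.

Let below' : 0 < m' - l' * x3.
Proof. exact: (small_root_lt_inverse_load (root_relations_env rel)). Qed.

Let x1_neq0 : x1 != 0. Proof. by rewrite gt_eqF// (lt_trans _ x1_gt1). Qed.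
Let x2_neq0 : x2 != 0. Proof. by rewrite gt_eqF// (lt_trans _ x2_gt1). Qed.
Let x12 : x1 - x2 != 0.
Proof. by rewrite subr_eq0; exact: (roots_distinct rel). Qed.

Let mode1 := mode_equation rel
  l_gt0 m_gt0 l'_gt0 m'_gt0 x1_neq0 below below' x3_lt1.
Let mode2 := mode_equation (root_relations_swap rel)
  l_gt0 m_gt0 l'_gt0 m'_gt0 x2_neq0 below below' x3_lt1.

Lemma balance_interior n :
  l * u n + m * u n.+2 + e * u' n.+1 - (l + m + e) * u n.+1 = 0.
Proof.
rewrite /u /u' /two_mode !exprS.
move: mode1 mode2.
move: (scale l _ _ _ _ _ _) (scale l' _ _ _ _ _ _) => k k' E1 E2.
move: (x1^-1 ^+ n) (x2^-1 ^+ n) => y1 y2.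
transitivity ((y1 * x1^-1 ^+ 2 *
      (k * ((m - l * x2) * ((l * x1 - m) * (x1 - 1) - e * x1))
       + e * x1 * (k' * (m' - l' * x2)))
    - y2 * x2^-1 ^+ 2 *
      (k * ((m - l * x1) * ((l * x2 - m) * (x2 - 1) - e * x2))
       + e * x2 * (k' * (m' - l' * x1)))) / (x1 - x2)).
  by field; rewrite x12 x1_neq0 x2_neq0.
by rewrite E1 E2 !mulr0 subrr mul0r.
Qed.

(** At the empty queue the missing arrival and departure flows are those of a
    fictitious level -1; the choice of the two coefficients makes them equal. *)
Lemma balance_boundary :
  m * u 1 + e * u' 0 - (l + e) * u 0 = 0.
Proof.
rewrite /u /u' /two_mode !expr1 !expr0.
move: mode1 mode2.
move: (scale l _ _ _ _ _ _) (scale l' _ _ _ _ _ _) => k k' E1 E2.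
transitivity ((x1^-1 *
      (k * ((m - l * x2) * ((l * x1 - m) * (x1 - 1) - e * x1))
       + e * x1 * (k' * (m' - l' * x2)))
    - x2^-1 *
      (k * ((m - l * x1) * ((l * x2 - m) * (x2 - 1) - e * x2))
       + e * x2 * (k' * (m' - l' * x1)))) / (x1 - x2)).
  by field; rewrite x12 x1_neq0 x2_neq0.
by rewrite E1 E2 !mulr0 subrr mul0r.
Qed.

End Balance.
End StationaryForm.

(** * Roots of the polynomial of the queue *)

Section QueueRoots.
Variables (R : realType) (lambda mu eta : bool -> R).
Implicit Types (i : bool) (x : R).

Definition relations x1 x2 x3 i := root_relations (lambda i) (mu i) (eta i)
  (lambda (~~ i)) (mu (~~ i)) (eta (~~ i)) x1 x2 x3.

Lemma cubic_expand (a b c : R) :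
  ('X - a%:P) * ('X - b%:P) * ('X - c%:P)
  = 'X^3 - (a + b + c) *: 'X^2 + (a * b + a * c + b * c) *: 'X - (a * b * c)%:P.
Proof. by rewrite -!mul_polyC !(polyCD, polyCM); ring. Qed.

Lemma queue_roots_relations x1 x2 x3 i :
  queue_roots lambda mu eta x1 x2 x3 -> relations x1 x2 x3 i.
Proof.
case=> _ _ _; move: (lead_coef _) => c; rewrite cubic_expand /queue_poly /=.
move=> /(congr1 (fun q : {poly R} => (q`_0, q`_1, q`_2, q`_3))).
rewrite !(coefD, coefN, coefZ, coefC, coefXn, coefX) /=.
move=> [c0 c1 c2 c3].
have cE : c = lambda env1 * lambda env2 by lra.
rewrite cE in c0 c1 c2.
by rewrite /relations; case: i; split=> /=; lra.
Qed.

Hypotheses (lambda_gt0 : forall i, 0 < lambda i) (mu_gt0 : forall i, 0 < mu i)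
  (eta_gt0 : forall i, 0 < eta i).

Lemma relations_queue_roots x1 x2 x3 : 1 < x1 -> 1 < x2 -> 0 < x3 < 1 ->
  relations x1 x2 x3 env1 -> queue_roots lambda mu eta x1 x2 x3.
Proof.
move=> x11 x21 x301 [/= r1 r2 r3].
have E : queue_poly lambda mu eta = (lambda env1 * lambda env2) *:
    (('X - x1%:P) * ('X - x2%:P) * ('X - x3%:P)).
  rewrite cubic_expand /queue_poly -r1 -r2 -r3 -!mul_polyC !(polyCD, polyCM).
  by ring.
split=> //; rewrite {2}E lead_coefZ !lead_coefM !lead_coefXsubC !mulr1.
by [].
Qed.

(** The polynomial is negative at 0, positive at 1 and nonpositive at the
    larger of the two inverse loads, which exceeds 1. This gives a root below 1
    and one above; the third is then read off the constant coefficient. *)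
Lemma queue_roots_exist : 0 < drift lambda mu eta ->
  exists x1 x2 x3, queue_roots lambda mu eta x1 x2 x3.
Proof.
rewrite /drift => drift0.
pose P := queue_poly lambda mu eta.
have PE z : P.[z] = lambda env1 * lambda env2 * z ^+ 3
  - (lambda env1 * lambda env2 + lambda env1 * mu env2 + lambda env1 * eta env2
     + mu env1 * lambda env2 + eta env1 * lambda env2) * z ^+ 2
  + (lambda env1 * mu env2 + mu env1 * lambda env2 + mu env1 * mu env2
     + mu env1 * eta env2 + eta env1 * mu env2) * z - mu env1 * mu env2.
  by rewrite /P /queue_poly !hornerE.
(* The environment with the smaller load lambda i / mu i has mu i > lambda i. *)
have [z z1 Pz] : exists2 z, 1 < z & P.[z] <= 0.
  have large i : lambda i * mu (~~ i) <= lambda (~~ i) * mu i ->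
      exists2 z, 1 < z & P.[z] <= 0.
    move=> le_load; exists (mu i / lambda i).
      rewrite ltr_pdivlMr// mul1r ltNge; apply/negP => ml.
      have ml' : mu (~~ i) <= lambda (~~ i).
        rewrite -(ler_pM2l (lambda_gt0 i)) (le_trans le_load)// mulrC.
        by rewrite ler_pM2r.
      have e1 : eta i * (mu (~~ i) - lambda (~~ i)) <= 0.
        by rewrite pmulr_rle0// subr_le0.
      have e2 : eta (~~ i) * (mu i - lambda i) <= 0.
        by rewrite pmulr_rle0// subr_le0.
      by move: drift0 e1 e2; case: (i) => /= *; lra.
    have -> : P.[mu i / lambda i] = - (mu i * eta i *
        (lambda (~~ i) * mu i - lambda i * mu (~~ i)) / lambda i ^+ 2).
      rewrite PE; case: (i) => /=; field; exact: lt0r_neq0.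
    by rewrite oppr_le0 divr_ge0 ?sqr_ge0// mulr_ge0 ?subr_ge0// mulr_ge0 ?ltW.
  by have [/(large env1)|/ltW/(large env2)] :=
    leP (lambda env1 * mu env2) (lambda env2 * mu env1).
have P0 : P.[0] < 0.
  by rewrite PE !expr0n /= !mulr0 subrr add0r sub0r oppr_lt0 mulr_gt0.
have P1 : 0 < P.[1] by rewrite PE !expr1n !mulr1; lra.
have [x3 /andP[x30 x31] /rootP x3P] : exists2 x, 0 <= x <= 1 & root P x.
  by apply: poly_ivt; rewrite ?ler01// (ltW P0) (ltW P1).
have [x1 /andP[x11 _] /rootP x1P] : exists2 x, 1 <= x <= z & root (- P) x.
  apply: poly_ivt; rewrite ?(ltW z1)//.
  by rewrite !hornerN oppr_le0 oppr_ge0 (ltW P1) Pz.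
have {x1P} x1P : P.[x1] = 0 by apply/eqP; rewrite -oppr_eq0 -hornerN x1P.
have {}x30 : 0 < x3.
  rewrite lt_neqAle x30 andbT; apply/eqP => x30'.
  by move: x3P P0; rewrite -x30' => ->; rewrite ltxx.
have {}x31 : x3 < 1.
  rewrite lt_neqAle x31 andbT; apply/eqP => x31'.
  by move: x3P P1; rewrite x31' => ->; rewrite ltxx.
have {}x11 : 1 < x1.
  rewrite lt_neqAle x11 andbT; apply/eqP => x11'.
  by move: x1P P1; rewrite -x11' => ->; rewrite ltxx.
have x10 : 0 < x1 by exact: lt_trans x11.
set L := lambda env1 * lambda env2.
have L0 : 0 < L by rewrite mulr_gt0.
pose x2 := mu env1 * mu env2 / (L * x1 * x3).
have r3 : L * (x1 * x2 * x3) = mu env1 * mu env2.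
  by rewrite /x2; field; rewrite !gt_eqF.
have r1 : L * (x1 + x2 + x3) =
    L + lambda env1 * mu env2 + lambda env1 * eta env2
    + mu env1 * lambda env2 + eta env1 * lambda env2.
  have x13 : (x1 - x3) * x1 * x3 != 0.
    by rewrite !mulf_neq0 ?gt_eqF// subr_gt0 (lt_trans x31).
  apply: (mulfI x13); apply/eqP; rewrite -subr_eq0; apply/eqP.
  rewrite -[RHS](_ : x3 * P.[x1] - x1 * P.[x3] = 0);
    last by rewrite x1P x3P !mulr0 subrr.
  rewrite !PE -/L -r3; ring.
have r2 : L * (x1 * x2 + x1 * x3 + x2 * x3) =
    lambda env1 * mu env2 + mu env1 * lambda env2 + mu env1 * mu env2
    + mu env1 * eta env2 + eta env1 * mu env2.
  apply: (mulfI (lt0r_neq0 x10)); apply/eqP; rewrite -subr_eq0; apply/eqP.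
  rewrite -[RHS](_ : - P.[x1] = 0); last by rewrite x1P oppr0.
  by rewrite PE -/L -r1 -r3; ring.
exists x1, x2, x3; apply: relations_queue_roots => //.
- have : 0 < L * ((x1 - 1) * (x2 - 1) * (1 - x3)).
    rewrite (_ : _ * _ = eta env1 * (mu env2 - lambda env2)
      + eta env2 * (mu env1 - lambda env1))//.
    by rewrite /L in r1 r2 r3 *; lra.
  by rewrite pmulr_rgt0// pmulr_lgt0 ?subr_gt0// pmulr_rgt0 ?subr_gt0.
- by rewrite x30.
Qed.

End QueueRoots.

(** * The steady state of the queue *)

Section Rates.
Variables (R : realType) (lambda mu eta : bool -> R).
Let Q := queue_rate lambda mu eta.

Lemma rate_arrival n i : Q (n, i) (n.+1, i) = lambda i.
Proof. by rewrite /Q /= !eqxx. Qed.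

Lemma rate_departure n i : Q (n.+1, i) (n, i) = mu i.
Proof. by rewrite /Q /= !eqxx ltn_eqF// ltnW. Qed.

Lemma rate_switch n i : Q (n, i) (n, ~~ i) = eta i.
Proof. by rewrite /Q /= eqxx; case: i. Qed.

Lemma rate_stay n i :
  Q (n, i) (n, i) = - (lambda i + eta i + (if (0 < n)%N then mu i else 0)).
Proof. by rewrite /Q /= !eqxx ltn_eqF. Qed.

End Rates.

Section SteadyState.
Variables (R : realType) (lambda mu eta : bool -> R).
Hypotheses (lambda_gt0 : forall i, 0 < lambda i) (mu_gt0 : forall i, 0 < mu i)
  (eta_gt0 : forall i, 0 < eta i).
Variables x1 x2 x3 : R.
Hypothesis roots : queue_roots lambda mu eta x1 x2 x3.

Definition mixture (s : state) : R := let: (n, i) := s in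
  eta (~~ i) / (eta env1 + eta env2) *
  (mix_weight lambda mu eta x1 x2 x3 i * geometric_pmf x1 n +
   (1 - mix_weight lambda mu eta x1 x2 x3 i) * geometric_pmf x2 n).

Let rel i := queue_roots_relations i roots.
Let x1_gt1 : 1 < x1. Proof. by case: roots. Qed.
Let x2_gt1 : 1 < x2. Proof. by case: roots. Qed.
Let x3_gt0 : 0 < x3. Proof. by case: roots => _ _ /andP[]. Qed.
Let x3_lt1 : x3 < 1. Proof. by case: roots => _ _ /andP[]. Qed.

Let N := eta env1 + eta env2.
Let N_gt0 : 0 < N. Proof. by rewrite addr_gt0. Qed.

Definition density i n : R :=
  scale (lambda i) (mu i) (eta i) (lambda (~~ i)) (mu (~~ i)) (eta (~~ i)) x3
  * two_mode (lambda i) (mu i) x1 x2 n.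

Lemma mixtureE n i : mixture (n, i) = eta (~~ i) / N * density i n.
Proof.
rewrite /mixture /density -(weight_mode (rel i))//; congr (_ * _).
rewrite /mix_weight /weight /drift.
by case: i => //=; rewrite ![eta false * _ + _]addrC.
Qed.

Lemma density_other i n : density (~~ i) n =
  scale (lambda (~~ i)) (mu (~~ i)) (eta (~~ i)) (lambda i) (mu i) (eta i) x3
  * two_mode (lambda (~~ i)) (mu (~~ i)) x1 x2 n.
Proof. by rewrite /density negbK. Qed.

Lemma mixture_gt0 s : 0 < mixture s.
Proof.
case: s => n i; rewrite mixtureE mulr_gt0 ?divr_gt0// /density mulr_gt0//.
  exact: (scale_gt0 (rel i)).
exact: (two_mode_gt0 _ (rel i)).
Qed.

Lemma mixture_balance y : exists s : seq state, [/\ uniq s, y \in s &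
  \sum_(x <- s) mixture x * queue_rate lambda mu eta x y = 0].
Proof.
case: y => -[|n] i.
  exists [:: (0, i); (1, i); (0, ~~ i)]; split.
  - by rewrite /= !inE !xpair_eqE /=; case: i.
  - by rewrite mem_head.
  rewrite !big_cons big_nil !mixtureE rate_stay rate_departure.
  rewrite -[X in queue_rate _ _ _ _ (_, X)]negbK rate_switch negbK /=.
  have := balance_boundary (rel i) (lambda_gt0 _) (mu_gt0 _) (eta_gt0 _)
    (lambda_gt0 _) (mu_gt0 _) (eta_gt0 _) x1_gt1 x2_gt1 x3_lt1.
  rewrite -density_other -!/(density i _) => E.
  rewrite -[RHS](mulr0 (eta (~~ i) / N)) -[X in _ = _ * X]E ?addr0; ring.
exists [:: (n.+1, i); (n, i); (n.+2, i); (n.+1, ~~ i)]; split.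
- have n1 : (n.+1 == n) = false by rewrite gtn_eqF.
  have n2 : (n == n.+2) = false by rewrite ltn_eqF.
  have n3 : (n == n.+1) = false by rewrite ltn_eqF.
  by rewrite /= !inE !xpair_eqE !eqSS n1 n2 n3 !eqxx; case: i.
- by rewrite mem_head.
rewrite !big_cons big_nil !mixtureE rate_stay rate_arrival rate_departure.
rewrite -[X in queue_rate _ _ _ _ (_, X)]negbK rate_switch negbK /=.
have := balance_interior (rel i) (lambda_gt0 _) (mu_gt0 _) (eta_gt0 _)
  (lambda_gt0 _) (mu_gt0 _) (eta_gt0 _) x1_gt1 x2_gt1 x3_lt1 n.
rewrite -density_other -!/(density i _) => E.
rewrite -[RHS](mulr0 (eta (~~ i) / N)) -[X in _ = _ * X]E ?addr0; ring.
Qed.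

Lemma geometric_pmf_sum (x : R) n :
  \sum_(0 <= k < n) geometric_pmf x k = 1 - x^-1 ^+ n.
Proof.
elim: n => [|n IH]; first by rewrite big_geq// expr0 subrr.
by rewrite big_nat_recr//= IH /geometric_pmf div1r exprS; ring.
Qed.

Lemma geometric_pmf_sum_cvg (x : R) : 1 < x ->
  \sum_(0 <= k < n) geometric_pmf x k @[n --> \oo] --> (1 : R).
Proof.
move=> x_gt1; under eq_fun do rewrite geometric_pmf_sum.
have x_gt0 : 0 < x by exact: lt_trans x_gt1.
have : `|x^-1| < 1 by rewrite gtr0_norm ?invr_gt0// invf_lt1.
move=> /(cvg_geometric 1); rewrite /geometric /=.
under eq_fun do rewrite mul1r.
by move=> /(cvgB (cvg_cst (1 : R))); rewrite subr0.
Qed.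

(** The partial sums over n are computed from the mixture form, in which each
    environment i has total mass eta (3 - i) / (eta 1 + eta 2). *)
Lemma mixture_mass : mass mixture = 1%E.
Proof.
have q0 s : (0 <= (mixture s)%:E)%E by rewrite lee_fin ltW// mixture_gt0.
transitivity (\esum_(n in [set: nat])
    \esum_(i in [set: bool]) (mixture (n, i))%:E).
  rewrite (@esum_esum _ _ _ _ (fun=> setT) (fun n i => (mixture (n, i))%:E))//.
  rewrite /mass (_ : _ `*`` _ = setT); last by apply/seteqP; split.
  by apply: eq_esum => -[].
transitivity (\esum_(n in [set: nat]) (\sum_(i : bool) mixture (n, i))%:E).
  apply: eq_esum => n _; rewrite (esumID [set true])// setTI esum_set1//.
  rewrite setTI (_ : ~` [set true] = [set false]) ?esum_set1// ?big_bool//.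
  by apply/seteqP; split=> -[] //= /(_ erefl).
rewrite -nneseries_esumT => [|n]; last first.
  by rewrite lee_fin sumr_ge0// => i _; rewrite -lee_fin.
apply: cvg_lim => //.
under eq_fun do rewrite sumEFin.
apply: cvg_EFin; first by apply: nearW.
pose a := mix_weight lambda mu eta x1 x2 x3.
have : \sum_(i : bool) eta (~~ i) / N *
    (a i * (\sum_(0 <= k < n) geometric_pmf x1 k) +
     (1 - a i) * (\sum_(0 <= k < n) geometric_pmf x2 k)) @[n --> \oo]
    --> \sum_(i : bool) eta (~~ i) / N * (a i * 1 + (1 - a i) * 1).
  rewrite big_bool; under eq_fun do rewrite big_bool.
  by apply: cvgD; apply: cvgM => //; try exact: cvg_cst;
    apply: cvgD; apply: cvgM => //; try exact: cvg_cst;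
    exact: geometric_pmf_sum_cvg.
rewrite (_ : \sum_(i : bool) _ = 1); last first.
  by rewrite big_bool /= /N; field; rewrite gt_eqF.
apply: cvg_trans; apply: near_eq_cvg; apply: nearW => n /=.
rewrite exchange_big/=; apply: eq_bigr => i _.
by rewrite -[RHS]mulr_sumr big_split/= !mulr_sumr.
Qed.

End SteadyState.

(** * State probabilities of the process *)

Section Law.
Context (R : realType) d (T : measurableType d) (P : probability T R).
Variable X : R -> {RV P >-> state}.

Lemma measurable_state (t : R) (s : state) : measurable (X t @^-1` [set s]).
Proof.
rewrite -[X in measurable X]setTI; apply: measurable_funP => //.
case: s => n i; rewrite (_ : [set (n, i)] = [set n] `*` [set i]).
  exact: measurableX.
by apply/seteqP; split=> [[a b] [-> ->]|[a b] /= [-> ->]].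
Qed.

Lemma state_probK (t : R) (s : state) :
  P (X t @^-1` [set s]) = (state_prob X t s)%:E.
Proof.
by rewrite /state_prob fineK// fin_num_measure//; exact: measurable_state.
Qed.

(** The two initial states carry all the mass, so X t = y splits, up to a null
    event, according to which of them the process starts from; the Markov
    property with empty past evaluates both parts. *)
Lemma state_prob_mix (p : R -> state -> state -> R) (a b : state) (r t : R) :
  a != b ->
  (forall (h : seq (R * state)) (s t : R) (x y : state),
      (forall e, e \in h -> 0 <= e.1 <= s) -> 0 <= s -> 0 <= t ->
      P ([set w | forall e, e \in h -> X e.1 w = e.2] `&`
         X s @^-1` [set x] `&` X (s + t) @^-1` [set y]) =
      (P ([set w | forall e, e \in h -> X e.1 w = e.2] `&`
          X s @^-1` [set x]) * (p t x y)%:E)%E) ->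
  state_prob X 0 a = r -> state_prob X 0 b = 1 - r -> 0 <= t ->
  forall y, state_prob X t y = r * p t a y + (1 - r) * p t b y.
Proof.
move=> ab markov Xa Xb t0 y.
have step x : P (X 0 @^-1` [set x] `&` X t @^-1` [set y])
    = (state_prob X 0 x * p t x y)%:E.
  have := markov [::] 0 t x y _ (lexx 0) t0.
  rewrite (_ : [set w | _] = setT) ?setTI ?add0r ?state_probK.
    by rewrite EFinM; apply.
  by apply/seteqP; split.
have mB := measurable_state t y; have mA := measurable_state 0.
have dis : X 0 @^-1` [set a] `&` X 0 @^-1` [set b] = set0.
  by apply/seteqP; split=> // w [/= -> /eqP]; rewrite (negbTE ab).
set A := X 0 @^-1` [set a] `|` X 0 @^-1` [set b].
have mAB : measurable A by exact: measurableU.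
have PA : P A = 1%E.
  transitivity (P (X 0 @^-1` [set a]) + P (X 0 @^-1` [set b]))%E.
    exact: measureU.
  by rewrite !state_probK Xa Xb -EFinD addrC subrK.
have PAC : P (~` A) = 0%E by rewrite probability_setC// PA subee.
apply: EFin_inj; rewrite -state_probK.
pose B := X t @^-1` [set y].
transitivity (P (B `&` A) + P (B `&` ~` A))%E.
  rewrite -measureU; last 3 first.
  - exact: measurableI.
  - by apply: measurableI => //; exact: measurableC.
  - by rewrite setIACA setICr setI0.
  by rewrite -setIUr setUv setIT.
have -> : P (B `&` ~` A) = 0%E.
  apply/eqP; rewrite eq_le measure_ge0 andbT -PAC le_measure// ?inE//.
    by apply: measurableI => //; exact: measurableC.
  exact: measurableC.
rewrite adde0 setIUr.
transitivity (P (B `&` X 0 @^-1` [set a]) + P (B `&` X 0 @^-1` [set b]))%E.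
  apply: measureU; [exact: measurableI|exact: measurableI|].
  by rewrite setIACA dis setI0.
by rewrite ![B `&` _]setIC !step Xa Xb EFinD.
Qed.

End Law.

Theorem proposition1 (R : realType) (d : measure_display)
  (T : measurableType d) (P : probability T R)
  (lambda mu eta : bool -> R) (j : nat) (p : R)
  (X : R -> {RV P >-> state})
  (lambda_gt0 : forall i, 0 < lambda i)
  (mu_gt0 : forall i, 0 < mu i)
  (eta_gt0 : forall i, 0 < eta i)
  (stable : 0 < eta env1 * (mu env2 - lambda env2)
              + eta env2 * (mu env1 - lambda env1))
  (p01 : 0 <= p <= 1)
  (X_chain : markov_chain (queue_rate lambda mu eta) X)
  (X_init1 : state_prob X 0 (j, env1) = p)
  (X_init2 : state_prob X 0 (j, env2) = 1 - p) :
  (exists xi1 xi2 xi3 : R, queue_roots lambda mu eta xi1 xi2 xi3) /\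
  (exists2 q : state -> R, steady_state X q &
     forall xi1 xi2 xi3 : R, queue_roots lambda mu eta xi1 xi2 xi3 ->
     forall (n : nat) (i : bool),
       q (n, i) = eta (~~ i) / (eta env1 + eta env2) *
         (mix_weight lambda mu eta xi1 xi2 xi3 i * geometric_pmf xi1 n +
          (1 - mix_weight lambda mu eta xi1 xi2 xi3 i) * geometric_pmf xi2 n)).
Proof.
have roots_exist := queue_roots_exist lambda_gt0 mu_gt0 eta_gt0 stable.
split=> //.
have [pt tf markov] := X_chain.
pose K := \sum_(i : bool) (lambda i + mu i + eta i).
have rates_gt0 i : 0 < lambda i + mu i + eta i by rewrite !addr_gt0.
have K_gt0 : 0 < K by rewrite /K big_bool addr_gt0.
have QK x : - K <= queue_rate lambda mu eta x x.
  case: x => n i; rewrite rate_stay lerN2 /K big_bool.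
  have := rates_gt0 (~~ i).
  have := mu_gt0 i.
  by case: ifP => _; case: i => /=; lra.
have edge x y : x != y -> 0 < queue_rate lambda mu eta x y ->
    forall t, 0 < t -> 0 < pt t x y.
  by move=> xy Qxy t t0; exact: (tf_edge_gt0 tf (ltW K_gt0)).
(* Serve all customers one by one, then switch to the first environment. *)
have reach t x : 0 < t -> 0 < pt t x (0, env1).
  move=> + ; case: x => n i; elim: n t => [|n IH] t t0.
    case: i; last exact: (tf_diag_gt0 tf (ltW K_gt0) (QK _) (ltW t0)).
    by apply: edge => //; rewrite (rate_switch _ _ _ _ env2).
  have t2 : 0 < t / 2 by rewrite divr_gt0.
  rewrite [t]splitr.
  apply: lt_le_trans (tf_mul tf _ (n, i) _ (ltW t2) (ltW t2)).
  rewrite mulr_gt0 ?IH//; apply: edge => //; last by rewrite rate_departure.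
  by rewrite xpair_eqE gtn_eqF.
(* This holds for every triple of roots, in either order of the first two. *)
have steady x1 x2 x3 : queue_roots lambda mu eta x1 x2 x3 ->
    steady_state X (mixture lambda mu eta x1 x2 x3).
  move=> roots.
  have q_gt0 := mixture_gt0 lambda_gt0 mu_gt0 eta_gt0 roots.
  have q_mass := mixture_mass lambda_gt0 mu_gt0 eta_gt0 roots.
  have q_bal := mixture_balance lambda_gt0 mu_gt0 eta_gt0 roots.
  have q_inv := balance_invariant tf q_gt0 q_mass K_gt0 QK q_bal.
  have cvg_pt := transition_cvg tf q_gt0 q_mass q_inv
    (fun x => reach 1 x ltr01).
  split=> [s||s]; [exact: ltW|exact: q_mass|].
  set q := mixture _ _ _ _ _ _.
  have : p * pt t (j, env1) s + (1 - p) * pt t (j, env2) s @[t --> +oo]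
      --> p * q s + (1 - p) * q s.
    by apply: cvgD; apply: cvgM;
      [exact: cvg_cst|exact: cvg_pt|exact: cvg_cst|exact: cvg_pt].
  rewrite -mulrDl subrKC mul1r; apply: cvg_trans; apply: near_eq_cvg.
  near=> t; have t0 : 0 <= t by near: t; exact: nbhs_pinfty_ge.
  by rewrite (state_prob_mix _ markov X_init1 X_init2 t0)// xpair_eqE andbF.
have [x1 [x2 [x3 roots]]] := roots_exist.
exists (mixture lambda mu eta x1 x2 x3); first exact: steady.
move=> y1 y2 y3 roots' n i.
have [_ _ lim] := steady _ _ _ roots; have [_ _ lim'] := steady _ _ _ roots'.
exact: (cvg_unique _ (lim (n, i)) (lim' (n, i))).
Unshelve. all: by end_near. Qed.
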